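(* Suppose $C\sqrt{n/\log n}\le d\le n^{1-\xi}$ for some constant $\xi\in(0,1/2]$ and a sufficiently large constant $C>0$. Then: (i) There exists a configuration $(K,v,P)$, with $K=O(1)$, $v\in\mathbb{R}^n$ a fixed unit vector and $P$ satisfying the eigenvalue-gap condition and $d\ge C'\log n$ (the hypotheses of the projection concentration bound), under which, for sufficiently large $n$, with high probability $$\|(\hat W\hat W^T-WW^T)v\|\ge c/d$$ for a constant $c>0$. (ii) There exists a configuration $(K,p,X,P,\beta,\theta,\alpha)$ with $K,p=O(1)$, satisfying (A1), (A2), the eigenvalue-gap condition, $d\ge C'\log n$, and $\min\{1-\sigma_{r+1},\sigma_{r+s}\}\ge1/4$, under which, for sufficiently large $n$, the estimator $\hat\beta$ computed with $\hat P=A$ satisfies, with high probability (over $A$), $\|\mathbb{E}\hat\beta-\beta\|_\infty\ge c'/d$ while $\max_j\mathrm{Var}(\hat\beta_j)\le C''/n$, for constants $c',C''>0$.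
   Context: Random network: $A$ is a symmetric binary matrix with entries $A_{ij}$, $i\le j$, independent Bernoulli with $\mathbb{P}(A_{ij}=1)=P_{ij}$, $\mathbb{E}A=P$; $d=n\max_{ij}P_{ij}$. $W\in\mathbb{R}^{n\times K}$ (resp. $\hat W$) has orthonormal eigenvectors of $P$ (resp. $A$) for the $K$ largest eigenvalues as columns. Eigenvalue-gap condition: eigenvalues $\lambda_1\ge\dots\ge\lambda_n$ of $P$ satisfy $\min_{i\le K,i'>K}|\lambda_i-\lambda_{i'}|\ge\rho'd$ and $\max_{i,i'\le K}|\lambda_i-\lambda_{i'}|\le d/\rho'$ for a constant $\rho'>0$; $C'$ is a sufficiently large constant. Regression setting: $X\in\mathbb{R}^{n\times p}$ fixed of rank $p$, $Z$ orthonormal basis of $\mathrm{col}(X)$, singular values of $Z^TW$ are $\sigma_1=\dots=\sigma_r=1>\sigma_{r+1}\ge\dots\ge\sigma_{r+s}>0=\cdots$ with $r=\dim(\mathrm{col}(X)\cap S_K(P))$, $S_K(P)=\mathrm{col}(W)$; $U,V$ orthogonal with $Z^TW=U\Sigma V^T$. Model $Y=X\beta+X\theta+\alpha+\epsilon$, $\epsilon\sim N(0,\sigma^2 I_n)$ independent of $A$, with $X\theta\in\mathcal R$, $X\beta\perp\mathcal R$, $\alpha\in S_K(P)$, $\alpha\perp\mathcal R$, $\mathcal R=\mathrm{col}(X)\cap S_K(P)$. Estimator with $\hat P=A$: SVD $Z^T\hat W=\hat U\hat\Sigma\hat V^T$, $\hat Z=Z\hat U$, $\breve W=\hat W\hat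 V$, $\hat M=(\hat Z_{(r+1):p},\breve W_{(r+1):K})$ (columns $r+1..p$ and $r+1..K$), $\hat{\mathcal P}_{\mathcal C}=(\hat Z_{(r+1):p},0)(\hat M^T\hat M)^{-1}\hat M^T$, $\hat\beta=(X^TX)^{-1}X^T\hat{\mathcal P}_{\mathcal C}Y$; expectations and variances of $\hat\beta$ are over $\epsilon$ given $A$. (A1): every column of $X$ has norm $\sqrt n$ and $\|X\beta+X\theta+\alpha\|\le C_0\sqrt{np}$ for a constant $C_0$. (A2): $\Theta=(X^TX/n)^{-1}$ has eigenvalues in $[\rho,1/\rho]$ for a constant $\rho>0$. An event holds with high probability if its probability is at least $1-n^{-c}$ for some constant $c>2$. *)

(* Defs.v *)
From HB Require Import structures.
From mathcomp Require Import all_boot all_order all_algebra.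
From mathcomp Require Import boolp reals exp.
Set Implicit Arguments. Unset Strict Implicit. Unset Printing Implicit Defensive.
Import Order.TTheory GRing.Theory Num.Theory.
Local Open Scope ring_scope.

Section Defs.
Variable R : realType.

Definition vnorm n (x : 'cV[R]_n) : R := Num.sqrt (\sum_i x i ord0 ^+ 2).

Definition vnorm_inf n (x : 'cV[R]_n) : R := \big[Num.max/0]_i `|x i ord0|.

Definition maxentry n (P : 'M[R]_n) : R := \big[Num.max/0]_(ij : 'I_n * 'I_n) P ij.1 ij.2.

Definition dparam n (P : 'M[R]_n) : R := n%:R * maxentry P.

Definition top_eigdecomp n K m (M : 'M[R]_n) (W : 'M[R]_(n, K)) (W' : 'M[R]_(n, m))
    (lamK : 'rV[R]_K) (lamR : 'rV[R]_m) : Prop :=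
  [/\ W^T *m W = 1%:M /\ W'^T *m W' = 1%:M, W^T *m W' = 0,
      W *m W^T + W' *m W'^T = 1%:M,
      M *m W = W *m diag_mx lamK /\ M *m W' = W' *m diag_mx lamR
    & forall i j, lamR 0 j <= lamK 0 i].

Definition top_eigvecs n K (M : 'M[R]_n) (W : 'M[R]_(n, K)) : Prop :=
  exists m (W' : 'M[R]_(n, m)) lamK lamR, top_eigdecomp M W W' lamK lamR.

Definition eig_gap n K (M : 'M[R]_n) (rho' d : R) : Prop :=
  exists m (W : 'M[R]_(n, K)) (W' : 'M[R]_(n, m)) lamK lamR,
    top_eigdecomp M W W' lamK lamR /\
    (forall i j, rho' * d <= `|lamK 0 i - lamR 0 j|) /\
    (forall i i', `|lamK 0 i - lamK 0 i'| <= d / rho').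

Definition prob_matrix n (P : 'M[R]_n) : Prop :=
  P^T = P /\ forall i j, 0 <= P i j <= 1.

Definition adj_of n (a : {ffun 'I_n * 'I_n -> bool}) : 'M[R]_n :=
  \matrix_(i, j) (a (i, j))%:R.

Definition sym_ff n (a : {ffun 'I_n * 'I_n -> bool}) : bool :=
  [forall i, forall j, a (i, j) == a (j, i)].

(* probability of a symmetric binary pattern a: independent Bernoulli(P_ij), i <= j *)
Definition weightA n (P : 'M[R]_n) (a : {ffun 'I_n * 'I_n -> bool}) : R :=
  if sym_ff a then
    \prod_(ij : 'I_n * 'I_n | (ij.1 <= ij.2)%N)
       (if a ij then P ij.1 ij.2 else 1 - P ij.1 ij.2)
  else 0.

Definition probA n (P : 'M[R]_n) (E : 'M[R]_n -> Prop) : R :=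
  \sum_(a : {ffun 'I_n * 'I_n -> bool} | `[< E (adj_of a) >]) weightA P a.

Definition whp (pr : nat -> R) : Prop :=
  exists c : R, 2 < c /\ exists N : nat, forall n : nat, (N <= n)%N ->
    1 - (n%:R) `^ (- c) <= pr n.

Definition orthobasis n p (X Z : 'M[R]_(n, p)) : Prop :=
  Z^T *m Z = 1%:M /\ (Z^T == X^T)%MS.

Definition svd p K (B : 'M[R]_(p, K)) (U : 'M[R]_p) (S : 'M[R]_(p, K)) (V : 'M[R]_K) : Prop :=
  [/\ U^T *m U = 1%:M /\ V^T *m V = 1%:M, B = U *m S *m V^T,
      forall (i : 'I_p) (j : 'I_K), (i : nat) <> j -> S i j = 0,
      forall (i : 'I_p) (j : 'I_K), (i : nat) = j -> 0 <= S i j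
    & forall (i : 'I_p) (j : 'I_K) (i' : 'I_p) (j' : 'I_K), (i : nat) = j -> (i' : nat) = j' -> (i <= i')%N -> S i' j' <= S i j].

(* r = dim(col(X) ∩ S_K(P)), S_K(P) = col(W) *)
Definition rdim n p K (X : 'M[R]_(n, p)) (W : 'M[R]_(n, K)) : nat :=
  \rank (X^T :&: W^T)%MS.

Lemma shift_ord_proof r p (i : 'I_(p - r)) : (r + i < p)%N.
Proof. case: i => i /= Hi; rewrite -ltn_subRL; exact: Hi. Qed.

Definition shift_ord r p (i : 'I_(p - r)) : 'I_p := Ordinal (shift_ord_proof i).

Definition lastcols n p r (M : 'M[R]_(n, p)) : 'M[R]_(n, p - r) :=
  colsub (@shift_ord r p) M.

(* \hat P_C built from Z, \hat W and an SVD  Z^T \hat W = \hat U \hat S \hat V^T *)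
Definition PChat n p K r (Z : 'M[R]_(n, p)) (What : 'M[R]_(n, K))
    (Uh : 'M[R]_p) (Vh : 'M[R]_K) : 'M[R]_n :=
  let Zs := lastcols r (Z *m Uh) in
  let Ws := lastcols r (What *m Vh) in
  let M := row_mx Zs Ws in
  row_mx Zs (0 : 'M[R]_(n, K - r)) *m invmx (M^T *m M) *m M^T.

(* \hat beta = Lmat Y *)
Definition Lmat n p (X : 'M[R]_(n, p)) (PC : 'M[R]_n) : 'M[R]_(p, n) :=
  invmx (X^T *m X) *m X^T *m PC.

(* E_eps[\hat beta] for Y = mu + eps, eps ~ N(0, sigma^2 I) *)
Definition Ebetahat n p (L : 'M[R]_(p, n)) (mu : 'cV[R]_n) : 'cV[R]_p := L *m mu.

Definition Varbetahat n p (L : 'M[R]_(p, n)) (sigma : R) (j : 'I_p) : R :=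
  sigma ^+ 2 * (L *m L^T) j j.

Definition eigs_in p (M : 'M[R]_p) (lo hi : R) : Prop :=
  exists (Q : 'M[R]_p) (lam : 'rV[R]_p),
    Q^T *m Q = 1%:M /\ M = Q *m diag_mx lam *m Q^T /\ forall i, lo <= lam 0 i <= hi.

End Defs.

(* Main.v *)
Require Import Defs.
From HB Require Import structures.
From mathcomp Require Import all_boot all_order all_algebra.
From mathcomp Require Import boolp reals sequences exp.
From mathcomp Require Import zify ring lra.
Import Order.TTheory GRing.Theory Num.Theory.
Local Open Scope ring_scope.

(** Both parts use one rank-two graph with K = 1. With k = (n-1)/4 and x = d/n,
    put probability x between the vertex classes [0,2k) and [2k,4k) and 0
    elsewhere; the last vertex is isolated. The top eigenvector w of P is constant
    on [0,4k), with eigenvalue 2kx of order d.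

    Let h be a top eigenvector of A and g = w.h. From
    (A - l)w = (A - l)(w - g h) one gets |(A - l)w|^2 <= 4 D^2 (1 - g^2), where D
    bounds the degrees. Pairing vertices i and k+i, on which w takes the same
    value, gives |(A - l)w|^2 >= sum_i (deg i - deg (k+i))^2 / (8k) whatever l is.
    The degrees are at most 16d and that sum is at least kd/16 except with
    probability n e^(-3d) + e^(-k/32), so 1 - g^2 >= c/d.

    (i) For v = w, |(hh^T - ww^T)w|^2 = 1 - g^2.
    (ii) Take p = 1, X = sqrt n (3/5 w + 4/5 e) with e the isolated vertex, beta =
    theta = 0 and alpha = sqrt n w. As h vanishes at e exactly, the bias is
    s(1 - g^2)/(1 - s^2 g^2) with s = 3/5: the first-order terms, which could cancel
    the second-order bias s(1 - g^2), are absent. *)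

(** * Product Bernoulli measures: exponential moments and moments of differences *)

Section ProductMeasure.
Context {R : realType} {I : finType} (p : I -> R).
Implicit Types (f : {ffun I -> bool}) (F : {ffun I -> bool} -> R).

Definition bern (x : R) (b : bool) : R := if b then x else 1 - x.

Definition pmass f : R := \prod_i bern (p i) (f i).

Definition Ex F : R := \sum_f pmass f * F f.

Definition upd f i b : {ffun I -> bool} := [ffun j => if j == i then b else f j].

Definition indep_of F (i : I) := forall f b, F (upd f i b) = F f.

Lemma Ex1 : Ex (fun=> 1) = 1.
Proof.
rewrite /Ex; under eq_bigr do rewrite mulr1.
rewrite -(bigA_distr_bigA (fun i b => bern (p i) b)) big1 // => i _.
by rewrite big_bool /= /bern addrC subrK.
Qed.

Lemma eq_Ex F G : F =1 G -> Ex F = Ex G.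
Proof. by move=> FG; apply: eq_bigr => f _; rewrite FG. Qed.

Lemma ExD F G : Ex (fun f => F f + G f) = Ex F + Ex G.
Proof. by rewrite /Ex -big_split; apply: eq_bigr => f _; rewrite mulrDr. Qed.

Lemma ExZ c F : Ex (fun f => c * F f) = c * Ex F.
Proof. by rewrite /Ex mulr_sumr; apply: eq_bigr => f _; rewrite mulrCA. Qed.

Lemma Ex_sum (J : Type) (s : seq J) (F : J -> {ffun I -> bool} -> R) :
  Ex (fun f => \sum_(j <- s) F j f) = \sum_(j <- s) Ex (F j).
Proof.
by rewrite /Ex exchange_big /=; apply: eq_bigr => f _; rewrite mulr_sumr.
Qed.

(** Both sides are the factors away from [i] times the two weights at [i]. No division occurs, so
    [p i] may be 0 or 1. *)
Lemma pmass_upd f i b :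
  pmass (upd f i b) * bern (p i) (f i) = pmass f * bern (p i) b.
Proof.
rewrite /pmass (bigD1 i) //= [in RHS](bigD1 i) //= ffunE eqxx.
under eq_bigr => j /negPf ji do rewrite ffunE ji.
ring.
Qed.

(* Redrawing one coordinate preserves the law: the swap (f, b) |-> (f with b at i, f i)
   preserves the weight on pairs. Every use of independence goes through this. *)
Lemma resample F i :
  Ex F = Ex (fun f => p i * F (upd f i true) + (1 - p i) * F (upd f i false)).
Proof.
pose h (x : {ffun I -> bool} * bool) := (upd x.1 i x.2, x.1 i).
have hK : involutive h.
  case=> f b; rewrite /h /= ffunE eqxx; congr pair.
  by apply/ffunP => j; rewrite !ffunE; case: eqP => [->|].
transitivity (\sum_(x : {ffun I -> bool} * bool)
    pmass x.1 * bern (p i) x.2 * F x.1).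
  rewrite -(pair_big xpredT xpredT
    (fun f b => pmass f * bern (p i) b * F f)) /=.
  apply: eq_bigr => f _; rewrite big_bool /= /bern; ring.
rewrite (reindex_inj (inv_inj hK)) /=.
under eq_bigr do rewrite pmass_upd.
rewrite -(pair_big xpredT xpredT
    (fun f b => pmass f * bern (p i) b * F (upd f i b))) /=.
by apply: eq_bigr => f _; rewrite big_bool /= /bern; ring.
Qed.

Lemma Ex_coord (H : bool -> {ffun I -> bool} -> R) i :
  (forall b, indep_of (H b) i) ->
  Ex (fun f => H (f i) f) = Ex (fun f => p i * H true f + (1 - p i) * H false f).
Proof.
move=> Hi; rewrite (resample _ i); apply: eq_Ex => f.
by rewrite !ffunE eqxx !Hi.
Qed.

Lemma Ex_coord2 (H : bool -> bool -> {ffun I -> bool} -> R) i j : i != j ->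
  (forall b c, indep_of (H b c) i) -> (forall b c, indep_of (H b c) j) ->
  Ex (fun f => H (f i) (f j) f) =
  Ex (fun f => p i * p j * H true true f + p i * (1 - p j) * H true false f
      + (1 - p i) * p j * H false true f
      + (1 - p i) * (1 - p j) * H false false f).
Proof.
move=> ij Hi Hj.
rewrite (Ex_coord (fun b f => H b (f j) f)) => [|b f c]; last first.
  by rewrite Hi ffunE eq_sym (negPf ij).
rewrite (Ex_coord (fun b f => p i * H true b f + (1 - p i) * H false b f)).
  by apply: eq_Ex => f; ring.
by move=> b f c; rewrite !Hj.
Qed.

Hypothesis p01 : forall i, 0 <= p i <= 1.

Lemma pmass_ge0 f : 0 <= pmass f.
Proof.
apply: prodr_ge0 => i _; have /andP[p0 p1] := p01 i.
by rewrite /bern; case: (f i); rewrite // subr_ge0.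
Qed.

Lemma le_Ex F G : (forall f, F f <= G f) -> Ex F <= Ex G.
Proof. by move=> FG; apply: ler_sum => f _; rewrite ler_wpM2l ?pmass_ge0. Qed.

Lemma Ex_ge0 F : (forall f, 0 <= F f) -> 0 <= Ex F.
Proof. by move=> F0; apply: sumr_ge0 => f _; rewrite mulr_ge0 ?pmass_ge0. Qed.

(** From e^(-x) >= 1 - x one gets (1 - x) e^x <= 1, and (1 - x)(1 + 2x) >= 1 on this range. *)
Lemma expR_le_1D2x (x : R) : 0 <= x <= 2^-1 -> expR x <= 1 + 2 * x.
Proof.
move=> x01; have := expR_ge1Dx (- x); rewrite expRN => h.
have e0 := expR_gt0 x.
have : (1 - x) * expR x <= 1 by rewrite -ler_pdivlMr // mul1r.
move=> h2; nra.
Qed.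

(** Chernoff's moment bound: by independence each coordinate contributes a factor p e^c + 1 - p <= 1
    + 2cp <= e^(2cp). *)
Lemma Ex_expR_count (J : eqType) (e : J -> I) (s : seq J) (c : R) :
  injective e -> uniq s -> 0 <= c <= 2^-1 ->
  Ex (fun f => expR (c * \sum_(j <- s) (f (e j))%:R)) <=
  expR (2 * c * \sum_(j <- s) p (e j)).
Proof.
move=> einj us c01; elim: s us => [|j s IH] /= => [_|/andP[js us]].
  rewrite big_nil mulr0 expR0 (_ : Ex _ = 1) // -Ex1.
  by apply: eq_Ex => f; rewrite big_nil mulr0 expR0.
pose S f := expR (c * \sum_(j <- s) (f (e j))%:R).
have S0 f : 0 <= S f by apply: expR_ge0.
have Sj : indep_of S (e j).
  move=> f b; rewrite /S !big_seq; congr (expR (c * _)); apply: eq_bigr => i si.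
  by rewrite ffunE (inj_eq einj); case: eqP si js => // -> ->.
pose H (b : bool) f := expR (c * b%:R) * S f.
rewrite (@eq_Ex _ (fun f => H (f (e j)) f)); last first.
  by move=> f; rewrite big_cons mulrDr expRD.
rewrite Ex_coord => [|b f b']; last by rewrite /H Sj.
rewrite (@eq_Ex _ (fun f => (p (e j) * expR c + (1 - p (e j))) * S f)); last first.
  by move=> f; rewrite /H /= mulr1 mulr0 expR0; ring.
rewrite ExZ big_cons mulrDr expRD.
have /andP[p0 p1] := p01 (e j).
apply: ler_pM (IH us) => //; last 1 first.
- apply: le_trans (expR_ge1Dx _).
  by have := expR_le_1D2x c c01; nra.
- by have := expR_gt0 c; nra.
- exact: Ex_ge0.
Qed.

Section Differences.
Context {J : eqType} (e1 e2 : J -> I) (x : R).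
Hypotheses (inj1 : injective e1) (inj2 : injective e2).
Hypothesis neq12 : forall j j', e1 j != e2 j'.
Hypotheses (p1 : forall j, p (e1 j) = x) (p2 : forall j, p (e2 j) = x).

Definition cdiff (s : seq J) f : R := \sum_(j <- s) ((f (e1 j))%:R - (f (e2 j))%:R).

(** A weight not involving the coordinates of [cdiff]; when rows are treated one at a time, it
    carries the factors of the remaining rows. *)
Variable W : {ffun I -> bool} -> R.
Hypotheses (W1 : forall j, indep_of W (e1 j)) (W2 : forall j, indep_of W (e2 j)).

(** Variance of the difference of two independent Bernoulli(x) variables. *)
Let v := 2 * x * (1 - x).

Lemma cdiff_indep1 j s : j \notin s -> indep_of (cdiff s) (e1 j).
Proof.
move=> js f b; rewrite /cdiff !big_seq; apply: eq_bigr => i si.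
rewrite !ffunE (inj_eq inj1) [e2 i == _]eq_sym (negPf (neq12 _ _)).
by case: eqP si js => // -> ->.
Qed.

Lemma cdiff_indep2 j s : j \notin s -> indep_of (cdiff s) (e2 j).
Proof.
move=> js f b; rewrite /cdiff !big_seq; apply: eq_bigr => i si.
rewrite !ffunE (inj_eq inj2) (negPf (neq12 _ _)).
by case: eqP si js => // -> ->.
Qed.

(** One more term is a step +1 or -1 with probability x(1 - x) each, and 0 otherwise. Taking [phi] a
    square or a fourth power gives the moment recursions. *)
Lemma Ex_cdiff_cons (phi : R -> R) j s : j \notin s ->
  Ex (fun f => W f * phi (cdiff (j :: s) f)) =
  Ex (fun f => W f * (x * (1 - x) * (phi (1 + cdiff s f) + phi (- 1 + cdiff s f))
                      + (1 - v) * phi (cdiff s f))).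
Proof.
move=> js.
pose H (b c : bool) f := W f * phi (b%:R - c%:R + cdiff s f).
rewrite (@eq_Ex _ (fun f => H (f (e1 j)) (f (e2 j)) f)); last first.
  by move=> f; rewrite /H /cdiff big_cons.
rewrite Ex_coord2 //; first last.
- by move=> b c f b'; rewrite /H W2 cdiff_indep2.
- by move=> b c f b'; rewrite /H W1 cdiff_indep1.
apply: eq_Ex => f; rewrite p1 p2 /H /= !(subrr, subr0, sub0r, add0r) /v; ring.
Qed.

Lemma Ex_cdiff2 s : uniq s ->
  Ex (fun f => W f * cdiff s f ^+ 2) = (size s)%:R * v * Ex W.
Proof.
elim: s => [_|j s IH /= /andP[js us]].
  rewrite !mul0r -(mul0r (Ex W)) -ExZ; apply: eq_Ex => f.
  by rewrite /cdiff big_nil expr0n mulr0 mul0r.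
rewrite (Ex_cdiff_cons (fun y => y ^+ 2)) //.
rewrite (@eq_Ex _ (fun f => W f * cdiff s f ^+ 2 + v * W f)) => [|f]; last first.
  by rewrite /v; ring.
rewrite ExD ExZ IH // -[(size s).+1]addn1 natrD; ring.
Qed.

(** Averaging (y + step)^4 gives y^4 + 6v y^2 + v; the second moment j v after j steps sums to the
    term 3m(m - 1)v^2, with m the size of [s]. *)
Lemma Ex_cdiff4 s : uniq s ->
  Ex (fun f => W f * cdiff s f ^+ 4) =
  ((size s)%:R * v + 3 * (size s)%:R * ((size s)%:R - 1) * v ^+ 2) * Ex W.
Proof.
elim: s => [_|j s IH /= /andP[js us]].
  rewrite !(mul0r, mulr0, addr0) -(mul0r (Ex W)) -ExZ; apply: eq_Ex => f.
  by rewrite /cdiff big_nil expr0n mulr0 mul0r.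
rewrite (Ex_cdiff_cons (fun y => y ^+ 4)) //.
rewrite (@eq_Ex _ (fun f => W f * cdiff s f ^+ 4
     + (6 * v * (W f * cdiff s f ^+ 2) + v * W f))) => [|f]; last first.
  by rewrite /v; ring.
rewrite ExD IH // ExD !ExZ Ex_cdiff2 // -[(size s).+1]addn1 natrD; ring.
Qed.

Hypothesis W0 : forall f, 0 <= W f.

(** e^(-y) <= 1/(1 + y), and (1 + y)(1 - y + y^2) = 1 + y^3 >= 1. *)
Lemma expRN_le_quad (y : R) : 0 <= y -> expR (- y) <= 1 - y + y ^+ 2.
Proof.
move=> y0; rewrite expRN -[leRHS]invrK lef_pV2 ?posrE ?expR_gt0 ?invr_gt0;
  [|by nra..].
apply: le_trans (expR_ge1Dx y).
rewrite -[leLHS]mul1r ler_pdivrMr; last by nra.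
nra.
Qed.

(** With t = 1/(8V) the quadratic bound and the two moments give at most 1 - tV + t(tV) + 3(tV)^2.
    Since tV = 1/8 and t <= 1/8, this is at most 1 - 1/8 + 1/64 + 3/64 = 15/16. *)
Lemma Ex_expRN_cdiff s : uniq s -> 1 <= (size s)%:R * v ->
  Ex (fun f => W f * expR (- ((8 * ((size s)%:R * v))^-1 * cdiff s f ^+ 2))) <=
  15 / 16 * Ex W.
Proof.
move=> us; set V := _ * v => V1.
have V0 : 0 < V by lra.
set t := (8 * V)^-1.
have t0 : 0 < t by rewrite invr_gt0; lra.
have tV : t * V = 8^-1 by rewrite /t; field; lra.
apply: (@le_trans _ _ (Ex (fun f => W f +
   ((- t) * (W f * cdiff s f ^+ 2) + t ^+ 2 * (W f * cdiff s f ^+ 4))))).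
  apply: le_Ex => f.
  have c0 : 0 <= t * cdiff s f ^+ 2 by rewrite mulr_ge0 ?sqr_ge0 // ltW.
  have := ler_wpM2l (W0 f) (expRN_le_quad _ c0).
  by move=> /le_trans; apply; rewrite le_eqVlt; apply/orP; left; apply/eqP; ring.
rewrite !ExD !ExZ Ex_cdiff2 // Ex_cdiff4 // -/V.
have E0 : 0 <= Ex W by exact: Ex_ge0.
have -> : 3 * (size s)%:R * ((size s)%:R - 1) * v ^+ 2 =
  3 * V ^+ 2 - 3 * V * v by rewrite /V; ring.
have v0 : 0 <= v.
  have [v0|//] := ltP v 0; have : V <= 0 by rewrite /V mulr_ge0_le0 ?ler0n // ltW.
  lra.
have -> : Ex W + (- t * (V * Ex W) + t ^+ 2 * ((V + (3 * V ^+ 2 - 3 * V * v)) * Ex W))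
  = (1 - (t * V) + t * t * V + 3 * (t * V) ^+ 2 - 3 * t * v * (t * V)) * Ex W by ring.
apply: ler_wpM2r => //; rewrite tV.
have : t <= 8^-1 by rewrite -tV ler_peMr // ltW.
have : 0 <= t * v by rewrite mulr_ge0 // ltW.
have -> : t * t * V = t * (t * V) by ring.
rewrite tV; lra.
Qed.

End Differences.

(* Lower tail: each row contributes a factor 15/16 by [exp (-y) <= 1 - y + y^2] and
   the second and fourth moments of [cdiff]. *)
Lemma Ex_expRN_sum_cdiff (S J : eqType) (e1 e2 : S -> J -> I) (x : R)
    (r : seq S) (s : seq J) :
  (forall i j i' j', e1 i j = e1 i' j' -> i = i' /\ j = j') ->
  (forall i j i' j', e2 i j = e2 i' j' -> i = i' /\ j = j') ->
  (forall i j i' j', e1 i j != e2 i' j') ->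
  (forall i j, p (e1 i j) = x) -> (forall i j, p (e2 i j) = x) ->
  uniq r -> uniq s ->
  let V := (size s)%:R * (2 * x * (1 - x)) in
  1 <= V ->
  Ex (fun f => expR (- ((8 * V)^-1 * \sum_(i <- r) cdiff (e1 i) (e2 i) s f ^+ 2)))
  <= (15 / 16) ^+ size r.
Proof.
move=> inj1 inj2 neq p1 p2 ur us V V1; elim: r ur => [_|i r IH /= /andP[ir ur]].
  rewrite expr0 -Ex1; apply: le_Ex => f.
  by rewrite big_nil mulr0 oppr0 expR0.
pose W f := expR (- ((8 * V)^-1 * \sum_(i <- r) cdiff (e1 i) (e2 i) s f ^+ 2)).
have W0 f : 0 <= W f by exact: expR_ge0.
have W1 j : indep_of W (e1 i j).
  move=> f b; rewrite /W !big_seq; congr (expR (- (_ * _))); apply: eq_bigr => i' ir'.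
  congr (_ ^+ 2); apply: eq_bigr => j' _; rewrite !ffunE [e2 _ _ == _]eq_sym.
  rewrite (negPf (neq _ _ _ _)); case: eqP => // /inj1[ii _].
  by rewrite -ii ir' in ir.
have W2 j : indep_of W (e2 i j).
  move=> f b; rewrite /W !big_seq; congr (expR (- (_ * _))); apply: eq_bigr => i' ir'.
  congr (_ ^+ 2); apply: eq_bigr => j' _; rewrite !ffunE.
  rewrite (negPf (neq _ _ _ _)); case: eqP => // /inj2[ii _].
  by rewrite -ii ir' in ir.
rewrite exprS; apply: le_trans (ler_wpM2l _ (IH ur)); last by lra.
have := @Ex_expRN_cdiff J (e1 i) (e2 i) x _ _ _ _ _ W W1 W2 W0 s us V1.
move=> H; apply: le_trans (H _ _ _ _ _) => //.
- by apply: le_Ex => f; rewrite big_cons mulrDr opprD expRD mulrC.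
- by move=> j j' /inj1[].
- by move=> j j' /inj2[].
Qed.

End ProductMeasure.

(** * The random bipartite graph and its typical event *)

Section RandomGraph.
Context {R : realType}.

(* The weight [weightA] is the law of the symmetrization of an array of independent
   entries, of which only those with i <= j are used. *)
Definition symf {n} (f : {ffun 'I_n * 'I_n -> bool}) : {ffun 'I_n * 'I_n -> bool} :=
  [ffun ij : 'I_n * 'I_n => if (ij.1 <= ij.2)%N then f ij else f (ij.2, ij.1)].

Definition entry {n} (P : 'M[R]_n) (ij : 'I_n * 'I_n) : R := P ij.1 ij.2.

(** An asymmetric [a] has an empty fiber. Over a symmetric [a], the entries with i <= j are
    prescribed while those below the diagonal are free, and their weights sum to 1. *)
Lemma symf_fiber n (P : 'M[R]_n) a :
  \sum_(f | symf f == a) pmass (entry P) f = weightA P a.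
Proof.
rewrite /weightA; case: ifP => [/forallP sa|/negP nsa]; last first.
  rewrite big_pred0 // => f; apply/negP => /eqP fa; case: nsa; rewrite -fa.
  apply/forallP => i; apply/forallP => j; rewrite !ffunE /=.
  by case: ltngtP => // /val_inj ->.
pose Q (ij : 'I_n * 'I_n) b := (ij.1 <= ij.2)%N ==> (b == a ij).
transitivity (\sum_(f in family Q) \prod_ij bern (entry P ij) (f ij)).
  apply: eq_bigl => f; apply/eqP/familyP => [fa ij|fQ].
    by rewrite /in_mem /= /Q -fa ffunE; case: ifP => //=.
  apply/ffunP => -[i j]; rewrite ffunE /=; case: ifP => ij.
    by have := fQ (i, j); rewrite /in_mem /= /Q /= ij => /eqP.
  have := fQ (j, i); rewrite /in_mem /= /Q /= leq_eqVlt ltnNge ij orbT => /eqP ->.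
  by apply/eqP; move/forallP: (sa j); apply.
rewrite -(bigA_distr_big_dep Q (fun ij b => bern (entry P ij) b)).
rewrite (bigID (fun ij : 'I_n * 'I_n => (ij.1 <= ij.2)%N)) /=.
rewrite [X in _ * X]big1 => [|ij /negPf ij12]; last first.
  rewrite (eq_bigl xpredT) => [|b]; last by rewrite /Q ij12.
  by rewrite big_bool /= /bern addrC subrK.
rewrite mulr1; apply: eq_bigr => ij ij12.
by rewrite (big_pred1 (a ij)) // => b; rewrite /Q ij12.
Qed.

Lemma weightA_sum n (P : 'M[R]_n) (F : {ffun 'I_n * 'I_n -> bool} -> R) :
  \sum_a weightA P a * F a = Ex (entry P) (fun f => F (symf f)).
Proof.
rewrite /Ex [RHS](partition_big symf xpredT) //=; apply: eq_bigr => a _.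
rewrite -symf_fiber mulr_suml.
by apply: eq_bigr => f /eqP ->.
Qed.

(** Markov's inequality: where [E] fails, [bad] is at least 1. Arrays with an edge of probability 0
    have no mass, so [E] need only be checked on the others. *)
Lemma probA_ge n (P : 'M[R]_n) (E : 'M[R]_n -> Prop)
    (bad : {ffun 'I_n * 'I_n -> bool} -> R) :
  (forall i j, 0 <= P i j <= 1) -> (forall f, 0 <= bad f) ->
  (forall f : {ffun 'I_n * 'I_n -> bool},
     (forall ij, entry P ij = 0 -> f ij = false) -> bad f < 1 ->
     E (adj_of R (symf f))) ->
  1 - Ex (entry P) bad <= probA P E.
Proof.
move=> P01 bad0 good.
have -> : probA P E = \sum_a weightA P a * (`[< E (adj_of R a) >])%:R.
  rewrite /probA big_mkcond; apply: eq_bigr => a _.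
  by case: ifP; rewrite ?mulr1 ?mulr0.
rewrite weightA_sum -[X in X - _](Ex1 (entry P)) lerBlDr -ExD.
apply: ler_sum => f _.
have [->|nz] := eqVneq (pmass (entry P) f) 0; first by rewrite !mul0r.
apply: ler_wpM2l; first by apply: pmass_ge0 => ij; apply: P01.
have [b1|b1] := ltP (bad f) 1; last by apply: (le_trans b1); rewrite lerDr ler0n.
have Ef : E (adj_of R (symf f)).
  apply: good => // ij Pij; apply: contra_neqF nz => fij.
  by rewrite /pmass (bigD1 ij) //= fij /bern Pij mul0r.
by rewrite asboolT // lerDl.
Qed.

Definition bip {n} (k : nat) (i j : 'I_n) : bool :=
  (i < 2 * k <= j)%N && (j < 4 * k)%N || (j < 2 * k <= i)%N && (i < 4 * k)%N.

Definition bipmx n (k : nat) (x : R) : 'M[R]_n :=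
  \matrix_(i, j) (if bip k i j then x else 0).

Lemma bip_sym n k (i j : 'I_n) : bip k i j = bip k j i.
Proof. by rewrite /bip orbC. Qed.

(** The deterministic facts about the adjacency matrix from which the spectral estimates follow; the
    last says that degrees of paired vertices fluctuate as much as their variance suggests. *)
Definition bip_typical n (k : nat) (d : R) (A : 'M[R]_n.+1) : Prop :=
  [/\ A^T = A, forall i j, 0 <= A i j, forall i j, ~~ bip k i j -> A i j = 0,
      forall i, \sum_j A i j <= 16 * d
    & k%:R * d / 16 <=
      \sum_(i < k) (\sum_j A (inord i) j - \sum_j A (inord (k + i)) j) ^+ 2].

Lemma sum_bip_row n k (F : 'I_n.+1 -> R) : (4 * k <= n)%N ->
  (forall j : 'I_n.+1, ~~ (2 * k <= j < 4 * k)%N -> F j = 0) ->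
  \sum_j F j = \sum_(j < 2 * k) F (inord (2 * k + j)).
Proof.
move=> kn F0.
have -> : \sum_j F j = \sum_(0 <= m < n.+1) F (inord m).
  by rewrite big_mkord; apply: eq_bigr => j _; rewrite inord_val.
rewrite (@big_cat_nat _ _ _ (2 * k)) //=; last by lia.
rewrite big_nat big1 => [|m mk]; last by apply: F0; rewrite inordK; lia.
rewrite (@big_cat_nat _ _ _ (4 * k)) //=; [|lia..].
rewrite [X in _ + (_ + X)]big_nat [X in _ + (_ + X)]big1 => [|m mk]; last first.
  by apply: F0; rewrite inordK; lia.
rewrite add0r addr0 -{1}[(2 * k)%N]add0n big_addn.
have -> : (4 * k - 2 * k = 2 * k)%N by lia.
by rewrite big_mkord; apply: eq_bigr => j _; rewrite addnC.
Qed.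

(** The failure indicator is dominated by a sum of exponentials, one per vertex for its degree and
    one for all paired differences; their expectations are the two error terms. *)
Lemma prob_bip_typical n k (d : R) (E : 'M[R]_n.+1 -> Prop) :
  (0 < k)%N -> (4 * k <= n)%N -> (n < 8 * k)%N -> 4 <= d -> d <= n.+1%:R / 2 ->
  (forall A, bip_typical n k d A -> E A) ->
  1 - (n.+1%:R * expR (- (3 * d)) + expR (- (k%:R / 32)))
    <= probA (bipmx n.+1 k (d / n.+1%:R)) E.
Proof.
move=> k0 kn nk.
have iN m : (m < 4 * k)%N -> @inord n m = m :> nat by move=> mk; rewrite inordK //; lia.
have nbip i (j : 'I_n.+1) : (i < 2 * k)%N -> ~~ (2 * k <= j < 4 * k)%N ->
    ~~ bip k (inord i) j.
  by move=> ik jk; rewrite /bip iN; lia.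
have le_inord i j : (i < 2 * k)%N -> (j < 2 * k)%N ->
    (@inord n i <= @inord n (2 * k + j))%N.
  by move=> ik jk; rewrite !iN; lia.
have ltk i : (i < k)%N -> (i < 2 * k)%N /\ (k + i < 2 * k)%N by lia.
move=> d4 dn good.
set x := d / n.+1%:R; set P := bipmx _ _ _.
have n0 : 0 < n.+1%:R :> R by rewrite ltr0n.
have x0 : 0 <= x by rewrite divr_ge0 //; lra.
have x2 : x <= 2^-1 by rewrite ler_pdivrMr // mulrC.
have nx : n.+1%:R * x = d by rewrite /x mulrCA divff ?mulr1 // gt_eqF.
have P01 (ij : 'I_n.+1 * 'I_n.+1) : 0 <= entry P ij <= 1.
  by rewrite /entry mxE; case: ifP => _; lra.
have Px ij : entry P ij <= x by rewrite /entry mxE; case: ifP.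
(* The entry (v, j) of the symmetrized array is read at the sorted pair. For fixed [v] these pairs
   are distinct, so a degree is a sum of independent coordinates. *)
pose srt (v j : 'I_n.+1) := if (v <= j)%N then (v, j) else (j, v).
have srt_inj v : injective (srt v).
  move=> j j'; rewrite /srt; case: ifP => vj; case: ifP => vj' [] //.
  - by move=> vj1 vj2; rewrite -vj1 leqnn in vj'.
  - by move=> vj1 vj2; rewrite vj1 leqnn in vj.
have symf_srt f v j : symf f (v, j) = f (srt v j).
  by rewrite ffunE /srt /=; case: ifP.
(* The potential edges from vertices i and k + i to the second class. Their first index is the
   smaller one, so all these coordinates are independent. *)
pose e1 (i : 'I_k) (j : 'I_(2 * k)) : 'I_n.+1 * 'I_n.+1 :=
  (inord i, inord (2 * k + j)).
pose e2 (i : 'I_k) (j : 'I_(2 * k)) : 'I_n.+1 * 'I_n.+1 :=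
  (inord (k + i), inord (2 * k + j)).
have inj1 i j i' j' : e1 i j = e1 i' j' -> i = i' /\ j = j'.
  case: i i' j j' => [i ik] [i' i'k] [j jk] [j' j'k].
  move=> [] /(congr1 val) /= ii /(congr1 val) /= jj.
  by split; apply: val_inj; move: ii jj; rewrite /= !iN; lia.
have inj2 i j i' j' : e2 i j = e2 i' j' -> i = i' /\ j = j'.
  case: i i' j j' => [i ik] [i' i'k] [j jk] [j' j'k].
  move=> [] /(congr1 val) /= ii /(congr1 val) /= jj.
  by split; apply: val_inj; move: ii jj; rewrite /= !iN; lia.
have neq12 i j i' j' : e1 i j != e2 i' j'.
  case: i i' j j' => [i ik] [i' i'k] [j jk] [j' j'k].
  by apply/eqP => -[] /(congr1 val) /= ii _; move: ii; rewrite !iN; lia.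
have pe1 i j : entry P (e1 i j) = x.
  case: i j => [i ik] [j jk]; rewrite /entry mxE /bip /e1 /= !iN; try lia.
  by rewrite ifT //; lia.
have pe2 i j : entry P (e2 i j) = x.
  case: i j => [i ik] [j jk]; rewrite /entry mxE /bip /e2 /= !iN; try lia.
  by rewrite ifT //; lia.
set V : R := (2 * k)%:R * (2 * x * (1 - x)).
have kR : n.+1%:R <= 8 * k%:R :> R by rewrite -natrM ler_nat.
(* V = 4kx(1 - x) >= 2kx because x <= 1/2, and 8kx >= d. *)
have Vd : d / 4 <= V.
  have -> : V = 4 * k%:R * x * (1 - x) by rewrite /V natrM; ring.
  have : d <= 8 * k%:R * x by rewrite -nx ler_wpM2r.
  have kx : 0 <= k%:R * x by rewrite mulr_ge0.
  nra.
have V1 : 1 <= V by lra.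
pose D (f : {ffun 'I_n.+1 * 'I_n.+1 -> bool}) : R :=
  \sum_(i < k) cdiff (e1 i) (e2 i) (index_enum 'I_(2 * k)) f ^+ 2.
(* [bad f < 1] makes every exponent negative: each degree is below 16d, and [D f] exceeds 8V k/32 =
   kV/4 >= kd/16. *)
pose bad (f : {ffun 'I_n.+1 * 'I_n.+1 -> bool}) : R := \sum_(v < n.+1)
    expR (4^-1 * \sum_j (f (srt v j))%:R - 4 * d) +
  expR (k%:R / 32 - (8 * V)^-1 * D f).
apply: le_trans (_ : 1 - Ex (entry P) bad <= _); last first.
  apply: probA_ge => [i j|f|f supp bad1]; first exact: (P01 (i, j)).
    by rewrite /bad addr_ge0 ?expR_ge0 // sumr_ge0 // => v _; exact: expR_ge0.
  have Anz i j : ~~ bip k i j -> adj_of R (symf f) i j = 0.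
    move=> nb; rewrite mxE symf_srt supp // /srt /entry mxE.
    by case: (i <= j)%N; rewrite /= ?(negPf nb) // bip_sym (negPf nb).
  have badk : expR (k%:R / 32 - (8 * V)^-1 * D f) < 1.
    apply: le_lt_trans bad1; rewrite /bad lerDr.
    by rewrite sumr_ge0 // => v _; exact: expR_ge0.
  apply: good; split => //.
  - apply/matrixP => i j; rewrite !mxE !ffunE /=.
    by case: ltngtP => // /val_inj ->.
  - by move=> i j; rewrite mxE ler0n.
  - move=> v; have badv : expR (4^-1 * \sum_j (f (srt v j))%:R - 4 * d) < 1.
      apply: le_lt_trans bad1; rewrite /bad [X in _ <= X + _](bigD1 v) //= -addrA lerDl.
      by rewrite addr_ge0 ?expR_ge0 // sumr_ge0 // => *; exact: expR_ge0.
    under eq_bigr do rewrite mxE symf_srt.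
    by move: badv; rewrite expR_lt1; lra.
  - have -> : \sum_(i < k) (\sum_j adj_of R (symf f) (inord i) j -
        \sum_j adj_of R (symf f) (inord (k + i)) j) ^+ 2 = D f.
      apply: eq_bigr => -[i ik] _; congr (_ ^+ 2).
      have [i2 ki2] := ltk _ ik.
      rewrite !(@sum_bip_row _ k) //; last 2 first.
      + by move=> j jk; apply: Anz; exact: nbip.
      + by move=> j jk; apply: Anz; exact: nbip.
      rewrite /cdiff -sumrB; apply: eq_bigr => -[j jk] _.
      by rewrite !mxE !ffunE /= !le_inord.
    move: badk; rewrite expR_lt1 subr_lt0 => badk.
    have V8 : 0 < 8 * V by lra.
    have kd : k%:R * d / 4 <= k%:R * V by rewrite -mulrA ler_wpM2l.
    apply: ltW; apply: le_lt_trans (_ : 8 * V * (k%:R / 32) < _); first by lra.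
    by rewrite -ltr_pdivlMl // mulrC.
have sumc c : n.+1%:R * c = \sum_(j < n.+1) c by rewrite sumr_const card_ord mulr_natl.
rewrite lerD2l lerN2 /bad ExD lerD //.
- rewrite Ex_sum sumc; apply: ler_sum => v _.
  rewrite (eq_Ex _ _ (fun f => expR (- (4 * d)) *
      expR (4^-1 * \sum_(j <- index_enum 'I_n.+1) (f (srt v j))%:R))); last first.
    by move=> f; rewrite -expRD addrC.
  (* The mean degree is at most d, so the exponent is at most -4d + d/2 <= -3d. *)
  rewrite ExZ; apply: le_trans (ler_wpM2l (expR_ge0 _) _) _.
    apply: Ex_expR_count => //; first exact: index_enum_uniq.
    by lra.
  rewrite -expRD ler_expR.
  have : \sum_(j <- index_enum 'I_n.+1) entry P (srt v j) <= d.
    by rewrite -[leRHS]nx sumc; apply: ler_sum => j _; exact: Px.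
  lra.
- rewrite (eq_Ex _ _ (fun f => expR (k%:R / 32) * expR (- ((8 * V)^-1 * D f)))).
    rewrite ExZ.
    have := @Ex_expRN_sum_cdiff _ _ _ P01 _ _ e1 e2 x (index_enum 'I_k)
      (index_enum 'I_(2 * k)) inj1 inj2 neq12 pe1 pe2 (index_enum_uniq _)
      (index_enum_uniq _).
    have sk m : size (index_enum 'I_m) = m.
      by rewrite -[RHS](card_ord m) cardT enumT.
    rewrite !sk -/V => /(_ V1) le15.
    apply: le_trans (ler_wpM2l (expR_ge0 _) le15) _.
    (* (15/16)^k <= e^(-k/16) beats the prefactor e^(k/32), leaving e^(-k/32). *)
    have e16 : 15 / 16 <= expR (- (16^-1)) :> R.
      by apply: le_trans (expR_ge1Dx _); lra.
    have e16k : (15 / 16) ^+ k <= expR (- (k%:R / 16)) :> R.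
      rewrite -mulrN expRM_natl; apply: lerXn2r e16; rewrite nnegrE ?expR_ge0 //.
      lra.
    apply: le_trans (ler_wpM2l (expR_ge0 _) e16k) _.
    by rewrite -expRD ler_expR; lra.
  by move=> f; rewrite expRD.
Qed.
End RandomGraph.

(** * Orthonormal bases, the Rayleigh quotient and eigenvector perturbation *)

Section LinearAlgebra.
Local Set Implicit Arguments.
Local Unset Strict Implicit.
Context {R : realType}.

Definition dot {n} (x y : 'cV[R]_n) : R := (x^T *m y) 0 0.

Lemma dotE n (x y : 'cV[R]_n) : dot x y = \sum_i x i 0 * y i 0.
Proof. by rewrite /dot mxE; apply: eq_bigr => i _; rewrite mxE. Qed.

Lemma dotC n (x y : 'cV[R]_n) : dot x y = dot y x.
Proof. by rewrite !dotE; apply: eq_bigr => i _; rewrite mulrC. Qed.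

Lemma dotDr n (x y z : 'cV[R]_n) : dot x (y + z) = dot x y + dot x z.
Proof. by rewrite /dot mulmxDr mxE. Qed.

Lemma dotZr n a (x y : 'cV[R]_n) : dot x (a *: y) = a * dot x y.
Proof. by rewrite /dot -scalemxAr mxE. Qed.

Lemma dotNr n (x y : 'cV[R]_n) : dot x (- y) = - dot x y.
Proof. by rewrite /dot mulmxN mxE. Qed.

Lemma dotDl n (x y z : 'cV[R]_n) : dot (y + z) x = dot y x + dot z x.
Proof. by rewrite dotC dotDr !(dotC x). Qed.

Lemma dotZl n a (x y : 'cV[R]_n) : dot (a *: y) x = a * dot y x.
Proof. by rewrite dotC dotZr (dotC x). Qed.

Lemma dotNl n (x y : 'cV[R]_n) : dot (- y) x = - dot y x.
Proof. by rewrite dotC dotNr dotC. Qed.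

Definition dotlin := (dotDl, dotDr, dotZl, dotZr, dotNl, dotNr).

Lemma dot_mx n (x y : 'cV[R]_n) : x^T *m y = (dot x y)%:M.
Proof. exact: mx11_scalar. Qed.

Lemma dot_mulmx m n (A : 'M[R]_(m, n)) (x : 'cV[R]_m) (y : 'cV[R]_n) :
  dot x (A *m y) = dot (A^T *m x) y.
Proof. by rewrite /dot trmx_mul trmxK mulmxA. Qed.

Lemma dot_ge0 n (x : 'cV[R]_n) : 0 <= dot x x.
Proof. by rewrite dotE sumr_ge0 // => i _; rewrite -expr2 sqr_ge0. Qed.

Lemma vnormE n (x : 'cV[R]_n) : vnorm x = Num.sqrt (dot x x).
Proof.
by rewrite /vnorm dotE; congr (Num.sqrt _); apply: eq_bigr => i _; rewrite expr2.
Qed.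

(** Induction on the number m of missing columns: with fewer than n columns some nonzero [u] is
    orthogonal to all of them; normalize and append it. For m = 0 the matrix is square and its left
    inverse is a right inverse. *)
Lemma orthonormal_completion n m k (M : 'M[R]_(n, k)) :
  (k + m)%N = n -> M^T *m M = 1%:M ->
  exists W' : 'M[R]_(n, m),
    [/\ W'^T *m W' = 1%:M, M^T *m W' = 0 & M *m M^T + W' *m W'^T = 1%:M].
Proof.
elim: m k M => [|m IH] k M.
  rewrite addn0 => kn; case: n / kn M => M MM; exists 0.
  split; rewrite ?mulmx0 ?mul0mx ?addr0 //; last exact: mulmx1C.
  by apply/matrixP => -[].
move=> kn MM.
have kerM : kermx M != 0.
  rewrite -mxrank_eq0 mxrank_ker -lt0n subn_gt0.
  by rewrite (leq_ltn_trans (rank_leq_col M)) // -kn addnS ltnS leq_addr.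
have /rowV0Pn[u uM u0] : (kermx M != 0) by [].
have Mu0 : u *m M = 0 by apply/sub_kermxP.
have uu : 0 < dot u^T u^T.
  rewrite lt_neqAle dot_ge0 andbT eq_sym dotE; apply: contraNneq u0 => /eqP.
  rewrite psumr_eq0 => [/allP u0|i _]; last by rewrite -expr2 sqr_ge0.
  apply/eqP/rowP => i; have := u0 i (mem_index_enum _).
  by rewrite !mxE mulf_eq0 orbb => /eqP.
pose v := (Num.sqrt (dot u^T u^T))^-1 *: u^T.
have vv : v^T *m v = 1%:M.
  rewrite dot_mx /v !dotlin mulrA -invfM -expr2 sqr_sqrtr; last exact: ltW.
  by rewrite mulVf // gt_eqF.
have Mv : M^T *m v = 0.
  by rewrite /v -scalemxAr -trmx_mul Mu0 trmx0 scaler0.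
have [||W [WW NW E]] := IH _ (row_mx M v).
- by rewrite -kn addn1 addnS.
- rewrite tr_row_mx mul_col_row MM vv Mv -[v^T *m M]trmxK trmx_mul trmxK Mv trmx0.
  by rewrite -scalar_mx_block.
move: NW; rewrite tr_row_mx mul_col_mx -[0]vsubmxK => /eq_col_mx[].
rewrite !linear0 => MW vW.
rewrite -[m.+1]add1n; exists (row_mx v W); split.
- rewrite tr_row_mx mul_col_row WW vv vW -[W^T *m v]trmxK trmx_mul trmxK vW trmx0.
  by rewrite -scalar_mx_block.
- by rewrite mul_mx_row Mv MW row_mx0.
- by rewrite -E !tr_row_mx !mul_row_col addrA.
Qed.

(** Expand x in the eigenbasis: each squared coefficient is weighted by an eigenvalue at most
    [lamK 0 0]. *)
Lemma rayleigh_top n m (M : 'M[R]_n) (W : 'M[R]_(n, 1)) (W' : 'M[R]_(n, m)) lamK lamR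
    (x : 'cV[R]_n) :
  top_eigdecomp M W W' lamK lamR -> dot x (M *m x) <= lamK 0 0 * dot x x.
Proof.
case=> _ _ E [MW MW'] le.
have -> : M *m x = lamK 0 0 *: (W *m (W^T *m x)) + W' *m (diag_mx lamR *m (W'^T *m x)).
  rewrite -{1}[x]mul1mx -E mulmxDl mulmxDr !mulmxA MW MW'; congr (_ + _).
  rewrite -!mulmxA scalemxAr; congr (_ *m _).
  by rewrite [diag_mx _]mx11_scalar mxE eqxx mul_scalar_mx.
have Mxx : dot x x = dot (W^T *m x) (W^T *m x) + dot (W'^T *m x) (W'^T *m x).
  by rewrite -!dot_mulmx -dotDr !mulmxA -mulmxDl E mul1mx.
rewrite Mxx dotDr dotZr mulrDr (dot_mulmx W) (dot_mulmx W') lerD2l mul_diag_mx !dotE.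
rewrite mulr_sumr; apply: ler_sum => j _; rewrite [X in _ * X <= _]mxE mulrCA.
by rewrite ler_wpM2r -?expr2 ?sqr_ge0 // le.
Qed.

(** Cauchy-Schwarz in each row with weights A_ij, obtained from sum_j A_ij (D x_j - y)^2 >= 0 with y
    = (Ax)_i. Summing over rows leaves column sums, which symmetry bounds by D. *)
Lemma schur_test n (A : 'M[R]_n) (D : R) (x : 'cV[R]_n) :
  0 < D -> A^T = A -> (forall i j, 0 <= A i j) -> (forall i, \sum_j A i j <= D) ->
  dot (A *m x) (A *m x) <= D ^+ 2 * dot x x.
Proof.
move=> D0 As A0 AD.
have row i : (A *m x) i 0 ^+ 2 <= D * \sum_j A i j * x j 0 ^+ 2.
  set y := (A *m x) i 0.
  have yE : y = \sum_j A i j * x j 0 by rewrite /y mxE.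
  have : 0 <= \sum_j A i j * (D * x j 0 - y) ^+ 2.
    by apply: sumr_ge0 => j _; rewrite mulr_ge0 ?sqr_ge0.
  have -> : \sum_j A i j * (D * x j 0 - y) ^+ 2 =
     D ^+ 2 * (\sum_j A i j * x j 0 ^+ 2) - 2 * D * y * (\sum_j A i j * x j 0)
       + y ^+ 2 * \sum_j A i j.
    rewrite !mulr_sumr -sumrB -big_split; apply: eq_bigr => j _ /=; ring.
  rewrite -yE; move: (\sum_j A i j * x j 0 ^+ 2) => S.
  have := ler_wpM2l (sqr_ge0 y) (AD i).
  move=> h1 h2; rewrite -(ler_pM2l D0); nra.
rewrite !dotE (@le_trans _ _ (D * \sum_i \sum_j A i j * x j 0 ^+ 2)) //.
  by rewrite mulr_sumr; apply: ler_sum => i _; rewrite -expr2.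
rewrite expr2 -mulrA ler_pM2l // exchange_big mulr_sumr; apply: ler_sum => j _ /=.
rewrite -mulr_suml -expr2 ler_wpM2r ?sqr_ge0 //.
by apply: le_trans (AD j); rewrite -{2}As; apply: ler_sum => i _; rewrite mxE.
Qed.

(* [A w - l w = (A - l)(w - g h)] because [(A - l) h = 0]. *)
Lemma eigvec_angle n (A : 'M[R]_n) (D l g : R) (w h : 'cV[R]_n) :
  0 < D -> A^T = A -> (forall i j, 0 <= A i j) -> (forall i, \sum_j A i j <= D) ->
  A *m h = l *: h -> dot h h = 1 -> dot w w = 1 -> g = dot w h ->
  dot (A *m w - l *: w) (A *m w - l *: w) <= 4 * D ^+ 2 * (1 - g ^+ 2).
Proof.
move=> D0 As A0 AD Ah hh ww gE.
(* The same norm bound, applied to [h], controls the eigenvalue. *)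
have l2 : l ^+ 2 <= D ^+ 2.
  have := schur_test h D0 As A0 AD.
  by rewrite Ah !dotlin hh !mulr1.
pose z := w - g *: h.
have zz : dot z z = 1 - g ^+ 2.
  by rewrite /z !dotlin ww hh [dot h w]dotC -gE; ring.
have -> : A *m w - l *: w = A *m z - l *: z.
  rewrite /z mulmxBr -scalemxAr Ah !scalerBr !scalerA [l * g]mulrC.
  by rewrite opprB addrA subrK.
clearbody z; have zA := schur_test z D0 As A0 AD.
(* Parallelogram law: |Az - lz|^2 <= 2|Az|^2 + 2 l^2 |z|^2 <= 4 D^2 |z|^2. *)
have := dot_ge0 (A *m z + l *: z).
move: zA; rewrite !dotlin zz [dot z (A *m z)]dotC.
have : 0 <= 1 - g ^+ 2 by rewrite -zz dot_ge0.
nra.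
Qed.

(* Since [w] agrees on [a i] and [b i], the term [l w] cancels in the differences. *)
Lemma symmetric_pair_gap n k (A : 'M[R]_n) (l : R) (w : 'cV[R]_n) (a b : 'I_k -> 'I_n) :
  injective a -> injective b -> (forall i j, a i != b j) ->
  (forall i, w (a i) 0 = w (b i) 0) ->
  \sum_(i < k) ((A *m w) (a i) 0 - (A *m w) (b i) 0) ^+ 2 <=
  2 * dot (A *m w - l *: w) (A *m w - l *: w).
Proof.
move=> ainj binj ab wab; set z := A *m w - l *: w.
(* The ranges of [a] and [b] are disjoint, so no coordinate is counted twice. *)
have zz : \sum_(i < k) z (a i) 0 ^+ 2 + \sum_(i < k) z (b i) 0 ^+ 2 <= dot z z.
  pose F i := z i 0 ^+ 2.
  have -> : dot z z = \sum_i F i.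
    by rewrite dotE; apply: eq_bigr => i _; rewrite /F expr2.
  have img (e : 'I_k -> 'I_n) : injective e ->
      \sum_(i < k) F (e i) = \sum_j if j \in e @: setT then F j else 0.
    move=> einj; rewrite -big_mkcond big_imset /=; last by move=> ? ? _ _ /einj.
    by apply: eq_bigl => i; rewrite in_setT.
  rewrite (img a ainj) (img b binj) -big_split; apply: ler_sum => j _ /=.
  have F0 : 0 <= F j by exact: sqr_ge0.
  case: ifP => [/imsetP[i _ ->]|_]; case: ifP => [/imsetP[i' _ E]|_];
    rewrite ?addr0 ?add0r //.
  by have := ab i i'; rewrite E eqxx.
apply: le_trans (_ : 2 * (\sum_(i < k) z (a i) 0 ^+ 2 +
    \sum_(i < k) z (b i) 0 ^+ 2) <= _); last first.
  by rewrite ler_pM2l.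
rewrite -big_split mulr_sumr; apply: ler_sum => i _ /=.
have -> : (A *m w) (a i) 0 - (A *m w) (b i) 0 = z (a i) 0 - z (b i) 0.
  by rewrite /z !mxE wab; ring.
move: (z (a i) 0) (z (b i) 0) => u v.
by have := sqr_ge0 (u + v); nra.
Qed.

End LinearAlgebra.

(** * The estimator with one covariate and one eigenvector *)

Section SingleFactor.
Context {R : realType}.
Local Set Implicit Arguments.
Local Unset Strict Implicit.

Lemma orthogonal11 (u : 'M[R]_1) : u^T *m u = 1%:M -> exists2 c, c ^+ 2 = 1 & u = c%:M.
Proof.
move=> /matrixP/(_ 0 0); rewrite !mxE big_ord1 !mxE eqxx -expr2 => u2.
by exists (u 0 0) => //; exact: mx11_scalar.
Qed.

Lemma unit_dotE n (W : 'cV[R]_n) : W^T *m W = 1%:M -> dot W W = 1.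
Proof. by rewrite /dot => ->; rewrite mxE eqxx. Qed.

Lemma orthobasis_single n (x Z : 'cV[R]_n) a : a != 0 -> dot x x = 1 ->
  orthobasis (a *: x) Z -> exists2 c, c ^+ 2 = 1 & Z = c *: x.
Proof.
move=> a0 xx [ZZ /andP[ZX _]]; have [c Zc] := sub_rVP ZX.
have ZE : Z = (c * a) *: x by rewrite -[Z]trmxK Zc !linearZ /= trmxK scalerA.
exists (c * a) => //; have := unit_dotE ZZ; rewrite ZE !dotlin xx mulr1.
by rewrite expr2.
Qed.

Lemma lastcols0 n (M : 'cV[R]_n) : lastcols 0 M = M.
Proof.
by apply/matrixP => i j; rewrite mxE; congr (M _ _); apply: val_inj; case: j => -[].
Qed.

(** This is the oblique projection that fixes x and kills h. All bases are determined up to sign,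
    and the signs cancel because they enter squared. *)
Lemma PChat_single n (x h : 'cV[R]_n) (a : R) (U V : 'M[R]_1) :
  a ^+ 2 = 1 -> dot x x = 1 -> dot h h = 1 -> dot x h ^+ 2 < 1 ->
  U^T *m U = 1%:M -> V^T *m V = 1%:M ->
  PChat 0 (a *: x) h U V =
    (1 - dot x h ^+ 2)^-1 *: (x *m (x - dot x h *: h)^T).
Proof.
move=> a2 xx hh r1 /orthogonal11[u u2 ->] /orthogonal11[v v2 ->].
set r := dot x h in r1 *.
rewrite /PChat !lastcols0 !mul_mx_scalar scalerA.
set e := u * a; have e2 : e ^+ 2 = 1 by rewrite /e exprMn u2 a2 mulr1.
pose t := (1 - r ^+ 2)^-1.
have tr : t * (1 - r ^+ 2) = 1 by rewrite /t mulVf // subr_eq0 gt_eqF.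
set M := row_mx (e *: x) (v *: h).
have MM : M^T *m M = block_mx 1%:M (e * v * r)%:M (e * v * r)%:M 1%:M.
  rewrite /M tr_row_mx mul_col_row !dot_mx !dotlin xx hh [dot h x]dotC -/r.
  by congr block_mx; congr (_%:M); rewrite ?mulr1 -?expr2 //; ring.
(* Explicit inverse of the Gram matrix, whose determinant is 1 - r^2 > 0. *)
pose N : 'M[R]_(1 + 1) := block_mx t%:M (- t * e * v * r)%:M (- t * e * v * r)%:M t%:M.
have NM : M^T *m M *m N = 1%:M.
  rewrite MM /N mulmx_block -!scalar_mxM -!raddfD [RHS]scalar_mx_block.
  have ev : e * v * r * (- t * e * v * r) = - t * r ^+ 2.
    transitivity (- t * r ^+ 2 * (e ^+ 2 * v ^+ 2)); first by ring.
    by rewrite e2 v2 !mulr1.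
  rewrite ev.
  have -> : 1 * t + - t * r ^+ 2 = 1 by rewrite -[RHS]tr; ring.
  have -> : - t * r ^+ 2 + 1 * t = 1 by rewrite -[RHS]tr; ring.
  have -> : 1 * (- t * e * v * r) + e * v * r * t = 0 by ring.
  have -> : e * v * r * t + 1 * (- t * e * v * r) = 0 by ring.
  by rewrite !raddf0.
have Minv : invmx (M^T *m M) = N.
  have [Mu _] := mulmx1_unit NM.
  by rewrite -[LHS]mulmx1 -NM mulKmx.
rewrite Minv /N /M mul_row_block !mul0mx !addr0 tr_row_mx mul_row_col.
rewrite !mul_mx_scalar !linearZ /= -!scalemxAl -/t !scalerA.
rewrite raddfD /= linearZ /= raddfN /= mulmxDr -scalemxAr mulmxN scalerDr scalerN.
rewrite scalerN scalerA -scaleNr; congr (_ *: _ + _ *: _).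
  by rewrite -expr2 e2 mul1r.
transitivity (- (t * r * (e ^+ 2 * v ^+ 2))); first by ring.
by rewrite e2 v2 !mulr1.
Qed.

Lemma Lmat_single n (x y : 'cV[R]_n) (a t : R) : a != 0 -> dot x x = 1 ->
  Lmat (a *: x) (t *: (x *m y^T)) = (a^-1 * t) *: y^T.
Proof.
move=> a0 xx; rewrite /Lmat dot_mx !dotlin xx mulr1 invmx_scalar.
rewrite !linearZ /= mul_scalar_mx -!scalemxAl !scalerA.
rewrite mulmxA dot_mx xx mul_scalar_mx scale1r.
by congr (_ *: _); field.
Qed.

(** Here L is y^T / (a q) with y = x - sgh and q = 1 - (sg)^2. The values follow from y.w = s - s
    g^2 and |y|^2 = q; the scale a cancels in the mean. *)
Lemma estimator_single n (x w h Z : 'cV[R]_n) (a s g : R) (U S V : 'M[R]_1) :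
  0 < a -> 0 < s < 1 -> dot x x = 1 -> dot h h = 1 -> dot w w = 1 ->
  dot x w = s -> dot w h = g -> dot x h = s * g -> g ^+ 2 <= 1 ->
  orthobasis (a *: x) Z -> svd (Z^T *m h) U S V ->
  let L := Lmat (a *: x) (PChat 0 Z h U V) in
  L *m (a *: w) = (s * (1 - g ^+ 2) / (1 - (s * g) ^+ 2))%:M /\
  L *m L^T = ((a ^+ 2 * (1 - (s * g) ^+ 2))^-1)%:M.
Proof.
move=> a0 s01 xx hh ww xw wh xh g1 oZ [[UU VV] _ _ _ _].
have an0 : a != 0 by rewrite gt_eqF.
have [c c2 ->] := orthobasis_single an0 xx oZ.
have sg1 : (s * g) ^+ 2 < 1 by rewrite exprMn; nra.
have sg0 : 1 - (s * g) ^+ 2 != 0 by rewrite subr_eq0 gt_eqF.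
rewrite /= (PChat_single c2 xx hh) ?xh // Lmat_single //.
have hx : dot h x = s * g by rewrite dotC.
have hw : dot h w = g by rewrite dotC.
have yw : dot (x - s * g *: h) w = s * (1 - g ^+ 2).
  by rewrite !dotlin xw hw; ring.
have yy : dot (x - s * g *: h) (x - s * g *: h) = 1 - (s * g) ^+ 2.
  by rewrite !dotlin xx hh xh hx; ring.
move: sg0 yw yy; set q := 1 - (s * g) ^+ 2; set y := x - _ => q0 yw yy.
split.
  rewrite -scalemxAl -scalemxAr dot_mx yw !scale_scalar_mx.
  by congr (_%:M); field; rewrite an0 q0.
rewrite [(_ *: _)^T]linearZ /= trmxK -scalemxAl -scalemxAr dot_mx yy.
by rewrite !scale_scalar_mx; congr (_%:M); field; rewrite an0 q0.
Qed.

(** The disjunction accommodates the sign ambiguity of the basis and of the eigenvector. *)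
Lemma svd_single (a : R) (U S V : 'M[R]_1) : 0 <= a ->
  svd a%:M U S V \/ svd (- a)%:M U S V -> S 0 0 = a.
Proof.
move=> a0 sv.
have [[UU VV] aE S0] : [/\ U^T *m U = 1%:M /\ V^T *m V = 1%:M,
   (U *m S *m V^T) 0 0 ^+ 2 = a ^+ 2 & 0 <= S 0 0].
  case: sv => -[UV aE _ S0 _]; split => //; try exact: S0; rewrite -aE mxE eqxx //.
  exact: sqrrN.
have [u u2 uE] := orthogonal11 UU; have [v v2 vE] := orthogonal11 VV.
move: aE; rewrite uE vE tr_scalar_mx mul_mx_scalar mul_scalar_mx !mxE mulrA.
rewrite !exprMn u2 v2 !mul1r => /eqP; rewrite eqrXn2 // => /eqP //.
Qed.

End SingleFactor.

(** * Spectrum of the bipartite probability matrix and top eigenvectors of typical graphs *)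

Section Bipartite.
Local Set Implicit Arguments.
Local Unset Strict Implicit.
Context {R : realType}.

(** The common size 1/sqrt(4k) of the nonzero entries of a unit vector spread over 4k vertices. *)
Definition bipscale (k : nat) : R := (2 * Num.sqrt k%:R)^-1.

Definition bipvec n k : 'cV[R]_n :=
  \col_i (if (i < 4 * k)%N then bipscale k else 0).

(** The eigenvector of [bipmx] for the negative eigenvalue -2kx. *)
Definition bipsgn n k : 'cV[R]_n :=
  \col_i (if (i < 2 * k)%N then bipscale k
          else if (i < 4 * k)%N then - bipscale k else 0).

Context (n k : nat).
Hypotheses (k0 : (0 < k)%N) (kn : (4 * k <= n)%N).

Local Notation c := (bipscale k).
Local Notation w := (bipvec n.+1 k).
Local Notation w1 := (bipsgn n.+1 k).

Let c2 : c ^+ 2 * (4 * k%:R) = 1.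
Proof.
have kR : 0 < k%:R :> R by rewrite ltr0n.
rewrite /bipscale exprVn exprMn sqr_sqrtr ?ltW // -natrX mulVf //.
by rewrite mulf_neq0 // gt_eqF.
Qed.

Let sum_lt m (a : R) : (m <= n.+1)%N ->
  \sum_(i < n.+1) (if (i < m)%N then a else 0) = m%:R * a.
Proof.
move=> mn; rewrite -big_mkcond -(big_ord_widen _ (fun=> a) mn) sumr_const card_ord.
by rewrite mulr_natl.
Qed.

Lemma bipvec_unit : dot w w = 1.
Proof.
rewrite dotE -c2 mulrC -natrM -sum_lt; last by lia.
by apply: eq_bigr => i _; rewrite !mxE; case: ifP; rewrite ?mulr0 // expr2.
Qed.

Lemma bipsgn_unit : dot w1 w1 = 1.
Proof.
rewrite -bipvec_unit !dotE; apply: eq_bigr => i _; rewrite !mxE.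
by do 2 case: ifP; rewrite ?mulrNN //; lia.
Qed.

Lemma bipvec_sgn : dot w w1 = 0.
Proof.
transitivity (\sum_(i < n.+1) ((if (i < 2 * k)%N then 2 * c ^+ 2 else 0)
    - (if (i < 4 * k)%N then c ^+ 2 else 0))).
  rewrite dotE; apply: eq_bigr => i _; rewrite !mxE.
  by do 2 case: ifP; try lia; move=> *; ring.
rewrite sumrB !sum_lt; try lia.
by rewrite !natrM; ring.
Qed.

(** The difference of the two rank-one matrices cancels within a class and equals 2c^2 across the
    classes, where 2kx times 2c^2 is x. *)
Lemma bipmx_spectral x :
  bipmx n.+1 k x = (2 * k%:R * x) *: (w *m w^T - w1 *m w1^T).
Proof.
apply/matrixP => i j; rewrite !mxE !big_ord1 !mxE /bip.
have xE : x = 2 * k%:R * x * (2 * c ^+ 2)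
    by transitivity (c ^+ 2 * (4 * k%:R) * x); [rewrite c2 mul1r | ring].
rewrite [X in if _ then X else _]xE.
case: (ltnP i (2 * k)) => i2; case: (ltnP i (4 * k)) => i4;
  case: (ltnP j (2 * k)) => j2; case: (ltnP j (4 * k)) => j4; rewrite /=;
  try ring; exfalso; lia.
Qed.

Lemma bipmx_vec x : bipmx n.+1 k x *m w = (2 * k%:R * x) *: w.
Proof.
rewrite bipmx_spectral -scalemxAl mulmxBl -!mulmxA !dot_mx bipvec_unit dotC bipvec_sgn.
by rewrite raddf0 mulmx0 subr0 mulmx1.
Qed.

Lemma bipmx_sgn x : bipmx n.+1 k x *m w1 = (- (2 * k%:R * x)) *: w1.
Proof.
rewrite bipmx_spectral -scalemxAl mulmxBl -!mulmxA !dot_mx bipsgn_unit bipvec_sgn.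
by rewrite raddf0 mulmx0 sub0r mulmx1 scalerN scaleNr.
Qed.

(** The spectrum is 2kx, -2kx and 0, so the gap below the top eigenvalue is 2kx itself. *)
Lemma bipmx_eig_gap (x rho d : R) :
  0 < rho -> 0 <= d -> 0 <= x -> rho * d <= 2 * k%:R * x ->
  eig_gap 1 (bipmx n.+1 k x) rho d.
Proof.
move=> rho0 d0 x0; set l := 2 * k%:R * x => le_l.
have l0 : 0 <= l by rewrite !mulr_ge0.
have uu : (row_mx w w1)^T *m row_mx w w1 = 1%:M.
  rewrite tr_row_mx mul_col_row !dot_mx bipvec_unit bipsgn_unit [dot w1 _]dotC.
  by rewrite bipvec_sgn raddf0 -scalar_mx_block.
have [|W [WW + E]] := @orthonormal_completion _ _ n.-1 _ _ _ uu; first by lia.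
rewrite tr_row_mx mul_col_mx -[0]vsubmxK => /eq_col_mx[].
rewrite !linear0 => vW sW.
(* The columns of [W], orthogonal to w and w1, span the kernel and get eigenvalue 0. *)
exists (1 + n.-1)%N, w, (row_mx w1 W), (const_mx l), (row_mx (const_mx (- l)) 0).
have lamR j : (row_mx (const_mx (- l)) 0 : 'rV[R]_(1 + n.-1)) 0 j <= 0.
  by case: (splitP j) => j' jE; rewrite !mxE; case: splitP => *; rewrite mxE // oppr_le0.
split; [split|split].
- split; first by rewrite dot_mx bipvec_unit.
  rewrite tr_row_mx mul_col_row dot_mx bipsgn_unit sW WW -[W^T *m _]trmxK trmx_mul trmxK.
  by rewrite sW trmx0 -scalar_mx_block.
- by rewrite mul_mx_row dot_mx bipvec_sgn vW raddf0 row_mx0.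
- by rewrite -E !tr_row_mx !mul_row_col addrA.
- split.
    by rewrite bipmx_vec [diag_mx _]mx11_scalar !mxE eqxx mul_mx_scalar.
  rewrite mul_mx_row bipmx_sgn bipmx_spectral -scalemxAl mulmxBl -!mulmxA vW sW.
  rewrite !mulmx0 subr0 scaler0.
  apply/matrixP => i j; rewrite mul_mx_diag !mxE; case: splitP => j' _; rewrite !mxE.
    by rewrite mulrC.
  by rewrite mulr0.
- by move=> i j; rewrite [leRHS]mxE (le_trans (lamR j)).
- move=> i j; rewrite [const_mx l 0 i]mxE ger0_norm; last first.
    by rewrite subr_ge0 (le_trans (lamR j)).
  by apply: le_trans le_l _; rewrite lerBrDr gerDl.
- by move=> i i'; rewrite !mxE subrr normr0 divr_ge0 // ltW.
Qed.

(** Testing the Rayleigh quotient at w shows that the eigenvalue is at least 2kx > 0. Pairing the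
    eigenvector equation with w1 then forces the w1-component to vanish, leaving a multiple of w. *)
Lemma bipmx_top (x : R) (W : 'cV[R]_n.+1) : 0 < x -> top_eigvecs (bipmx n.+1 k x) W ->
  exists2 a, a ^+ 2 = 1 & W = a *: w.
Proof.
move=> x0 [m [W' [lamK [lamR td]]]].
set l := 2 * k%:R * x.
have l0 : 0 < l by rewrite !mulr_gt0 // ltr0n.
have := rayleigh_top w td; rewrite bipmx_vec -/l dotZr bipvec_unit !mulr1 => lK.
case: td => -[/unit_dotE WW _] _ _ [+ _] _.
rewrite [diag_mx _]mx11_scalar mul_mx_scalar mxE eqxx mulr1n => PW.
set a := dot w W; set b := dot w1 W.
have E : lamK 0 0 *: W = l *: (a *: w - b *: w1).
  by rewrite -PW bipmx_spectral -scalemxAl mulmxBl -!mulmxA !dot_mx !mul_mx_scalar.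
have Ea : lamK 0 0 * a = l * a.
  by rewrite {1}/a -dotZr E !dotlin bipvec_unit bipvec_sgn; ring.
have Eb : lamK 0 0 * b = - l * b.
  by rewrite {1}/b -dotZr E !dotlin bipsgn_unit dotC bipvec_sgn; ring.
have b0 : b = 0.
  have /eqP : (lamK 0 0 + l) * b = 0 by rewrite mulrDl Eb; ring.
  by rewrite mulf_eq0 gt_eqF /= => [/eqP //|]; rewrite addr_gt0 // (lt_le_trans l0).
have K0 : lamK 0 0 != 0 by rewrite gt_eqF // (lt_le_trans l0).
have WE : W = (l / lamK 0 0 * a) *: w.
  apply: (scalerI K0); rewrite E b0 scale0r subr0 !scalerA.
  by congr (_ *: _); field.
exists (l / lamK 0 0 * a) => //.
by rewrite -WW WE !dotlin bipvec_unit; ring.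
Qed.

Local Notation lo i := (@inord n (nat_of_ord i)).
Local Notation hi i := (@inord n (k + nat_of_ord i)).

Let inord4K m : (m < 4 * k)%N -> @inord n m = m :> nat.
Proof. by move=> mk; rewrite inordK //; lia. Qed.

Lemma bip_left_inj : injective (fun i : 'I_k => lo i).
Proof.
move=> [i ik] [j jk] /(congr1 val) /=; rewrite !inord4K => [ij||]; try lia.
exact: val_inj.
Qed.

Lemma bip_right_inj : injective (fun i : 'I_k => hi i).
Proof.
move=> [i ik] [j jk] /(congr1 val) /=; rewrite !inord4K => [/addnI ij||]; try lia.
exact: val_inj.
Qed.

Lemma bip_left_right (i j : 'I_k) : lo i != hi j.
Proof.
by case: i j => [i ik] [j jk]; apply/eqP => /(congr1 val) /=; rewrite !inord4K; lia.
Qed.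

Lemma bip_left_rightE (i : 'I_k) : w (lo i) 0 = w (hi i) 0.
Proof. by case: i => [i ik]; rewrite !mxE /= !inord4K ?ifT //; lia. Qed.

Lemma bip_typical_top (d : R) A (h : 'cV[R]_n.+1) : 0 < d -> bip_typical n k d A ->
  top_eigvecs A h ->
  [/\ dot h h = 1, h ord_max 0 = 0 & (2 ^+ 17 * d)^-1 <= 1 - dot w h ^+ 2].
Proof.
move=> d0 [As A0 Anz Adeg AD] [m [W' [lamK [lamR td]]]].
have ray := rayleigh_top w td.
case: td => -[/unit_dotE hh _] _ _ [+ _] _.
rewrite [diag_mx _]mx11_scalar mul_mx_scalar mxE eqxx mulr1n; set l := lamK 0 0 => Ah.
rewrite -/l bipvec_unit mulr1 in ray.
have cpos : 0 < c by rewrite invr_gt0 mulr_gt0 // sqrtr_gt0 ltr0n.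
have Aw i : (A *m w) i 0 = c * \sum_j A i j.
  rewrite mxE mulr_sumr; apply: eq_bigr => j _; rewrite mxE mulrC; case: ifP => // j4.
  by rewrite Anz ?mulr0 ?mul0r // /bip; lia.
have kR : 0 < k%:R :> R by rewrite ltr0n.
have D0 : 0 < k%:R * d / 16 by rewrite divr_gt0 ?mulr_gt0.
(* If l <= 0, the Rayleigh bound at w makes the sum of all degrees nonpositive; then all degrees
   vanish, against the lower bound [AD]. *)
have lpos : 0 < l.
  rewrite ltNge; apply/negP => lneg.
  have := lt_le_trans D0 AD; rewrite ltNge => /negP; apply.
  have : dot w (A *m w) = c ^+ 2 * \sum_i \sum_j A i j.
    rewrite dotE mulr_sumr; apply: eq_bigr => i _; rewrite Aw mxE; case: ifP => i4.
      by rewrite mulrA expr2.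
    by rewrite [X in _ = _ * X]big1 ?mulr0 ?mul0r // => j _; apply: Anz; rewrite /bip; lia.
  move=> dE; have : \sum_i \sum_j A i j <= 0.
    by rewrite -(pmulr_rle0 _ (exprn_gt0 2 cpos)) -dE (le_trans ray).
  have row0 i : 0 <= \sum_j A i j by apply: sumr_ge0.
  rewrite le_eqVlt ltNge sumr_ge0 // orbF psumr_eq0 // => /allP rows.
  rewrite big1 // => i _; rewrite !(eqP (rows _ (mem_index_enum _))) subrr expr0n //.
have Dpos : 0 < 16 * d by rewrite mulr_gt0.
split => //.
  (* As n >= 4k, the last vertex is isolated: l h vanishes there, and l is nonzero. *)
  have : (A *m h) ord_max 0 = 0.
    rewrite mxE big1 // => j _; rewrite Anz ?mul0r // /bip /=; lia.
  by rewrite Ah mxE => /eqP; rewrite mulf_eq0 gt_eqF //= => /eqP.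
have angle := eigvec_angle Dpos As A0 Adeg Ah hh bipvec_unit (erefl (dot w h)).
have := @symmetric_pair_gap R n.+1 k A l w (fun i => lo i) (fun i => hi i).
have -> : \sum_(i < k) ((A *m w) (lo i) 0 - (A *m w) (hi i) 0) ^+ 2 =
  c ^+ 2 * \sum_(i < k) (\sum_j A (inord i) j - \sum_j A (inord (k + i)) j) ^+ 2.
  by rewrite mulr_sumr; apply: eq_bigr => i _; rewrite !Aw -mulrBr exprMn.
move=> gap.
have {}gap : c ^+ 2 * (k%:R * d / 16) <= 2 * (4 * (16 * d) ^+ 2 * (1 - dot w h ^+ 2)).
  apply: le_trans (_ : _ <= _) (ler_wpM2l _ angle) => //.
  apply: le_trans (ler_wpM2l (sqr_ge0 c) AD)
    (gap bip_left_inj bip_right_inj bip_left_right bip_left_rightE).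
(* c^2 k = 1/4 gives the 64 = 2^6 on the left and 2 * 4 * 16^2 = 2^11 stands on the right, whence
   2^17. *)
have {}gap : d / 64 <= 2 ^+ 11 * d ^+ 2 * (1 - dot w h ^+ 2).
  have <- : c ^+ 2 * (k%:R * d / 16) = d / 64.
    by transitivity (c ^+ 2 * (4 * k%:R) * (d / 64)); [field | rewrite c2 mul1r].
  by apply: le_trans gap _; rewrite le_eqVlt; apply/orP; left; apply/eqP; ring.
rewrite -div1r ler_pdivrMr ?mulr_gt0 //.
have : d * 1 <= d * (2 ^+ 17 * d * (1 - dot w h ^+ 2)) by lra.
by rewrite ler_pM2l // mulrC.
Qed.

End Bipartite.

(** * Growth comparisons for the regime of [d] *)

Section Growth.
Context {R : realType}.

Lemma eventually_ge_nat (M : R) : exists N : nat, forall n, (N <= n)%N -> M <= n%:R.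
Proof.
exists (Num.bound `|M|) => n Nn.
rewrite (le_trans (ler_norm _)) // (le_trans (ltW (archi_boundP _))) //.
by rewrite ler_nat.
Qed.

(** A fourth root is enough: ln n <= 4 n^(1/4) makes even (ln n)^3 of order at most n^(3/4). *)
Definition qrt (x : R) : R := Num.sqrt (Num.sqrt x).

Lemma qrt4 x : 0 <= x -> qrt x ^+ 4 = x.
Proof.
by move=> x0; rewrite (exprM _ 2 2) sqr_sqrtr ?sqrtr_ge0 // sqr_sqrtr.
Qed.

Lemma ln_le_qrt x : 0 < x -> ln x <= 4 * qrt x.
Proof.
move=> x0; have s0 : 0 < qrt x by rewrite !sqrtr_gt0.
rewrite -{1}(qrt4 x (ltW x0)) lnXn // mulr_natl lerMn2r /=.
exact/ltW/ln_sublinear.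
Qed.

Lemma ln_linear (M : R) : 0 <= M ->
  exists N : nat, forall n, (N <= n)%N -> M * ln n%:R <= (n%:R : R).
Proof.
move=> M0; have [N HN] := eventually_ge_nat ((4 * M + 1) ^+ 4).
exists N => n Nn; have := HN _ Nn => n1.
have n0 : 0 < n%:R :> R by apply: lt_le_trans n1; rewrite exprn_gt0 //; lra.
have s1 : 4 * M + 1 <= qrt n%:R.
  have m0 : 0 <= 4 * M + 1 by lra.
  by rewrite -(@ler_pXn2r _ 4) ?nnegrE ?sqrtr_ge0 // qrt4 // ltW.
have lnq := ln_le_qrt _ n0.
rewrite -[leRHS](qrt4 _ (ltW n0)); move: lnq s1; move: (qrt _) => s lnq s1.
have s2 : s <= s ^+ 3 by rewrite -[leLHS]expr1 ler_weXn2l //; lra.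
have : M * ln n%:R <= M * (4 * s) by rewrite ler_wpM2l.
have : 4 * M * s <= s * s ^+ 3 by nra.
by rewrite -exprS; lra.
Qed.

(** After squaring, the claim is M^2 (ln n)^3 <= n, and (ln n)^3 <= 64 n^(3/4). *)
Lemma ln_le_sqrt (M : R) : 0 <= M ->
  exists N : nat, forall n, (N <= n)%N ->
    M * ln (n%:R : R) <= Num.sqrt (n%:R / ln (n%:R : R)).
Proof.
move=> M0; have [N HN] := eventually_ge_nat ((64 * M ^+ 2 + 1) ^+ 4).
have [N2 HN2] := eventually_ge_nat (expR 1).
exists (maxn N N2) => n; rewrite geq_max => /andP[/HN n1 /HN2 ne].
have n0 : 0 < n%:R :> R by apply: lt_le_trans ne; exact: expR_gt0.
have L1 : 1 <= ln (n%:R : R).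
  by rewrite -[leLHS](expRK 1) ler_ln // posrE expR_gt0.
have m0 : 0 < 64 * M ^+ 2 + 1 by have := sqr_ge0 M; lra.
have s1 : 64 * M ^+ 2 + 1 <= qrt n%:R.
  by rewrite -(@ler_pXn2r _ 4) ?nnegrE ?sqrtr_ge0 // ?qrt4 // ltW.
have lnq := ln_le_qrt _ n0.
rewrite -[leLHS]ger0_norm; last by rewrite mulr_ge0 //; lra.
rewrite -sqrtr_sqr ler_wsqrtr // ler_pdivlMr; last by lra.
rewrite exprMn -mulrA -exprSr -[leRHS](qrt4 _ (ltW n0)).
move: L1 lnq s1; move: (qrt _) (ln _) => s L L1 lnq s1.
have L3 : L ^+ 3 <= (4 * s) ^+ 3 by rewrite lerXn2r ?nnegrE //; lra.
apply: le_trans (ler_wpM2l (sqr_ge0 M) L3) _.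
rewrite exprMn [leRHS]exprS (_ : 4 ^+ 3 = 64); last by ring.
have s3 : 0 <= s ^+ 3 by rewrite exprn_ge0 //; lra.
by rewrite mulrA ler_wpM2r // mulrC; lra.
Qed.

Lemma powR_le_half (xi : R) : 0 < xi ->
  exists N : nat, forall n, (N <= n)%N -> (n%:R : R) `^ (1 - xi) <= n%:R / 2.
Proof.
move=> xi0; have [N HN] := eventually_ge_nat (2 `^ xi^-1).
exists N => n /HN n2.
have n0 : 0 < n%:R :> R by apply: lt_le_trans n2; exact: powR_gt0.
have h : 2 <= (n%:R : R) `^ xi.
  have -> : 2 = (2 `^ xi^-1) `^ xi :> R by rewrite -powRrM mulVf ?gt_eqF // powRr1.
  by apply: ge0_ler_powR; rewrite ?nnegrE ?powR_ge0 ?(ltW xi0) ?(ltW n0).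
rewrite powRB; last by apply/implyP => _; rewrite gt_eqF.
rewrite (powRr1 (ltW n0)) ler_pM2l // lef_pV2 ?posrE ?powR_gt0 //.
Qed.

Lemma sparse_regime (xi C' : R) (d : nat -> R) : 0 < xi -> 0 < C' ->
  (exists N0 : nat, forall n : nat, (N0 <= n)%N ->
     Num.sqrt (n%:R / ln (n%:R : R)) <= d n <= (n%:R : R) `^ (1 - xi)) ->
  exists N : nat, forall n : nat, (N <= n)%N ->
    let k := (n.-1 %/ 4)%N in
    [/\ (4 < n)%N, 4 <= d n, d n <= n%:R / 2, C' * ln (n%:R : R) <= d n
      & n%:R * expR (- (3 * d n)) + expR (- (k%:R / 32)) <= (n%:R : R) `^ (- 3)].
Proof.
move=> xi0 C0 [N0 H0].
(* The sum [C' + 4] yields both d >= C' ln n and d >= 4 ln n. *)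
have [N1 H1] := ln_le_sqrt (C' + 4) (addr_ge0 (ltW C0) (ler0n _ 4)).
have [N2 H2] := powR_le_half _ xi0.
(* 1024 = 4 * 256: since n <= 8k, k/32 >= n/256 >= 4 ln n. *)
have [N3 H3] := ln_linear 1024 (ler0n _ 1024).
have [N4 H4] := eventually_ge_nat (expR 1).
exists (N0 + N1 + N2 + N3 + N4 + 5)%N => n Nn.
have n5 : (4 < n)%N by lia.
have [N0n N1n N2n N3n N4n] : [/\ (N0 <= n)%N, (N1 <= n)%N, (N2 <= n)%N, (N3 <= n)%N
  & (N4 <= n)%N] by split; lia.
have n8 : (n <= 8 * (n.-1 %/ 4))%N by lia.
have n2 : (2 <= n)%N by lia.
have {N0n} /andP[dl du] := H0 _ N0n.
have {N1n H1} h1 := H1 _ N1n.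
have {N2n H2} h2 := H2 _ N2n.
have {N3n H3} h3 := H3 _ N3n.
have {N4n H4} ne := H4 _ N4n.
have n0 : 0 < n%:R :> R by apply: lt_le_trans ne; exact: expR_gt0.
have L1 : 1 <= ln (n%:R : R) by rewrite -[leLHS](expRK 1) ler_ln // posrE expR_gt0.
have kn : n%:R <= 8 * (n.-1 %/ 4)%:R :> R by rewrite -natrM ler_nat.
have nE : n%:R = expR (ln (n%:R : R)) by rewrite lnK.
have [d4 dC] : 4 * ln (n%:R : R) <= d n /\ C' * ln (n%:R : R) <= d n.
  by have := le_trans h1 dl; nra.
move: (n.-1 %/ 4)%N {n8} kn => k kn; split => //; first by lra.
  exact: le_trans du h2.
rewrite /powR gt_eqF // {1}nE -expRD mulNr.
move: L1 d4 h3 nE; move: (ln _) => L L1 d4 h3 nE.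
(* Each error term is at most n^(-4), and the spare factor 1/n <= 1/2 absorbs the sum of two. *)
have e2 : expR (- L) <= 2^-1.
  by rewrite expRN -nE lef_pV2 ?posrE // (ler_nat _ 2).
have A1 : expR (L + - (3 * d n)) <= expR (- (3 * L)) * expR (- L).
  by rewrite -expRD ler_expR; lra.
have A2 : expR (- (k%:R / 32)) <= expR (- (3 * L)) * expR (- L).
  by rewrite -expRD ler_expR; lra.
have := expR_gt0 (- (3 * L)); nra.
Qed.

End Growth.

(** * The covariate and the remaining model conditions *)

Section Covariate.
Local Set Implicit Arguments.
Local Unset Strict Implicit.
Context {R : realType}.

Definition lastvec n : 'cV[R]_n := \col_i ((i : nat) == n.-1)%:R.

(* Vertex [n.-1] is isolated in the graph, so eigenvectors of the adjacency matrix
   for nonzero eigenvalues vanish there. *)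
Definition covar n k : 'cV[R]_n := (3 / 5) *: bipvec n k + (4 / 5) *: lastvec n.

Context (n k : nat).
Hypotheses (k0 : (0 < k)%N) (kn : (4 * k <= n)%N).

Local Notation w := (bipvec n.+1 k : 'cV[R]_n.+1).
Local Notation x := (covar n.+1 k).

Lemma dot_lastvec (h : 'cV[R]_n.+1) : dot (lastvec n.+1) h = h ord_max 0.
Proof.
rewrite dotE (bigD1 ord_max) //= mxE eqxx mul1r big1 ?addr0 // => i ni.
rewrite mxE (_ : _ == _ = false) ?mul0r //.
by apply: contra_neqF ni => /eqP ij; exact: val_inj.
Qed.

Let w_last : w ord_max 0 = 0.
Proof. by rewrite mxE /= ltnNge kn. Qed.

Lemma covar_unit : dot x x = 1.
Proof.
have lw : dot (lastvec n.+1) w = 0 by rewrite dot_lastvec.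
have ll : dot (lastvec n.+1) (lastvec n.+1) = 1 :> R.
  by rewrite dot_lastvec mxE eqxx.
by rewrite !dotlin bipvec_unit // [dot w _]dotC lw ll; field.
Qed.

(** This is the singular value of the design. The triple 3, 4, 5 keeps x a unit vector and 3/5
    within [1/4, 3/4]. *)
Lemma dot_covar_bipvec : dot x w = 3 / 5.
Proof. by rewrite !dotlin bipvec_unit // dot_lastvec w_last; ring. Qed.

Lemma dot_covar (h : 'cV[R]_n.+1) : h ord_max 0 = 0 -> dot x h = 3 / 5 * dot w h.
Proof. by move=> h0; rewrite !dotlin dot_lastvec h0; ring. Qed.

(** The isolated vertex separates the lines: w vanishes there and x does not. Hence r = 0. *)
Lemma covar_cap (a b : R) : a != 0 -> ((a *: x)^T :&: (b *: w)^T)%MS = 0.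
Proof.
move=> a0; apply/eqP; rewrite -submx0; apply/rV_subP => v.
rewrite sub_capmx => /andP[/sub_rVP[s vx] /sub_rVP[t vw]].
have /eqP : v 0 ord_max = 0 by rewrite vw !mxE /= ltnNge kn /= !mulr0.
rewrite vx !mxE /= ltnNge kn /= mulr0 add0r eqxx !mulf_eq0 (negPf a0) /= invr_eq0.
by rewrite !pnatr_eq0 oner_eq0 /= !orbF => /eqP->; rewrite scale0r sub0mx.
Qed.

Lemma dparam_bipmx (d : R) : 0 <= d -> dparam (bipmx n.+1 k (d / n.+1%:R)) = d.
Proof.
move=> d0; have n0 : n.+1%:R != 0 :> R by rewrite pnatr_eq0.
set t := d / _; have t0 : 0 <= t by rewrite divr_ge0.
rewrite /dparam (_ : maxentry _ = t); first by rewrite /t mulrC divfK.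
apply/le_anti/andP; split.
  by apply: bigmax_le => // ij _; rewrite mxE; case: ifP.
have tE : bipmx n.+1 k t (inord 0) (inord (2 * k)) = t.
  by rewrite mxE /bip !inordK ?ifT //; lia.
rewrite -[leLHS]tE.
exact: (le_bigmax _ (fun ij => bipmx n.+1 k t ij.1 ij.2) (inord 0, inord (2 * k))).
Qed.

Lemma prob_matrix_bipmx (t : R) : 0 <= t <= 1 -> prob_matrix (bipmx n.+1 k t).
Proof.
move=> t01; split; first by apply/matrixP => i j; rewrite !mxE bip_sym.
by move=> i j; rewrite mxE; case: ifP => //; rewrite lexx ler01.
Qed.

End Covariate.

(** * Assembly of the two configurations *)

Theorem theorem5 (R : realType) (xi : R) :
  0 < xi <= 1 / 2 ->
  forall C' : R, 0 < C' ->
  exists C : R, 0 < C /\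
  forall d : nat -> R,
    (exists N0 : nat, forall n : nat, (N0 <= n)%N ->
        C * Num.sqrt (n%:R / ln (n%:R : R)) <= d n <= (n%:R : R) `^ (1 - xi)) ->
    (* (i) *)
    (exists (K : nat) (v : forall n, 'cV[R]_n) (P : forall n, 'M[R]_n)
            (rho' : R) (N1 : nat),
       0 < rho' /\
       (forall n : nat, (N1 <= n)%N ->
          [/\ prob_matrix (P n), dparam (P n) = d n, vnorm (v n) = 1,
              eig_gap K (P n) rho' (d n) & C' * ln (n%:R : R) <= d n]) /\
       exists c : R, 0 < c /\
       whp (fun n => probA (P n) (fun A =>
              forall W What : 'M[R]_(n, K),
                top_eigvecs (P n) W -> top_eigvecs A What ->
                c / d n <= vnorm ((What *m What^T - W *m W^T) *m v n))))
    /\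
    (* (ii) *)
    (forall sigma : R, 0 < sigma ->
     exists (K p : nat) (X : forall n, 'M[R]_(n, p)) (P : forall n, 'M[R]_n)
            (beta theta : forall n, 'cV[R]_p) (alpha : forall n, 'cV[R]_n)
            (C0 rho rho' : R) (N1 : nat),
       [/\ 0 < C0, 0 < rho & 0 < rho'] /\
       (forall n : nat, (N1 <= n)%N ->
          let mu := X n *m beta n + X n *m theta n + alpha n in
          [/\ prob_matrix (P n), dparam (P n) = d n,
              eig_gap K (P n) rho' (d n), C' * ln (n%:R : R) <= d n
            & [/\ \rank (X n) = p,
                  (* (A1) *)
                  (forall j : 'I_p, vnorm (col j (X n)) = Num.sqrt (n%:R)) /\
                    vnorm mu <= C0 * Num.sqrt (n%:R * p%:R),
                  (* (A2) *)
                  eigs_in (invmx ((n%:R)^-1 *: ((X n)^T *m X n))) rho (1 / rho)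
                &
                  (* model structure and singular value condition *)
                  forall W : 'M[R]_(n, K), top_eigvecs (P n) W ->
                    [/\ ((X n *m theta n)^T <= (X n)^T :&: W^T)%MS,
                        ((X n)^T :&: W^T)%MS *m (X n *m beta n) = 0,
                        ((alpha n)^T <= W^T)%MS,
                        ((X n)^T :&: W^T)%MS *m alpha n = 0
                      & forall (Z : 'M[R]_(n, p)) U S V,
                          orthobasis (X n) Z -> svd (Z^T *m W) U S V ->
                          forall (i : 'I_p) (j : 'I_K), (i : nat) = j ->
                            (rdim (X n) W <= i)%N ->
                            S i j = 0 \/ 1 / 4 <= S i j <= 3 / 4]]]) /\
       exists c' C'' : R, 0 < c' /\ 0 < C'' /\
       whp (fun n => probA (P n) (fun A =>
              forall (W What : 'M[R]_(n, K)) (Z : 'M[R]_(n, p)) Uh Sh Vh,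
                top_eigvecs (P n) W -> top_eigvecs A What ->
                orthobasis (X n) Z -> svd (Z^T *m What) Uh Sh Vh ->
                let mu := X n *m beta n + X n *m theta n + alpha n in
                let L := Lmat (X n) (PChat (rdim (X n) W) Z What Uh Vh) in
                c' / d n <= vnorm_inf (Ebetahat L mu - beta n) /\
                forall j : 'I_p, Varbetahat L sigma j <= C'' / n%:R))).
Proof.
(* C = 1 serves for every C', because sqrt(n / ln n) outgrows every multiple of ln n. *)
move=> /andP[xi0 _] C' C'0; exists 1; split => // d Hd.
have [|N regime] := sparse_regime xi C' d xi0 C'0.
  by have [N0 {}Hd] := Hd; exists N0 => n /Hd; rewrite mul1r.
clear Hd.
pose P n : 'M[R]_n := bipmx n (n.-1 %/ 4) (d n / n%:R).
pose v n : 'cV[R]_n := bipvec n (n.-1 %/ 4).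
have kbounds m : (4 < m.+1)%N ->
    [/\ (0 < m %/ 4)%N, (4 * (m %/ 4) <= m)%N & (m < 8 * (m %/ 4))%N].
  by clear; move=> m4; split; lia.
(* rho' = 1/4: the top eigenvalue 2k d/n is at least d/4 because n <= 8k. *)
have model n : (N <= n)%N ->
    [/\ prob_matrix (P n), dparam (P n) = d n, vnorm (v n) = 1,
        eig_gap 1 (P n) 4^-1 (d n) & C' * ln (n%:R : R) <= d n].
  move=> /regime; case: n => [[]//|m] /= [m4 d4 dm dC _].
  have [k0 km mk] := kbounds _ m4.
  have d0 : 0 <= d m.+1 by lra.
  have m0 : 0 < m.+1%:R :> R by rewrite ltr0n.
  split => //.
  - apply: prob_matrix_bipmx => //; rewrite divr_ge0 ?(ltW m0) // ler_pdivrMr //; lra.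
  - exact: dparam_bipmx.
  - by rewrite vnormE bipvec_unit ?sqrtr1.
  - apply: bipmx_eig_gap => //; rewrite ?invr_gt0 ?divr_ge0 ?(ltW m0) //.
    have mk8 : m.+1%:R <= 8 * (m %/ 4)%:R :> R by rewrite -natrM ler_nat.
    rewrite mulrA ler_pdivlMr //.
    by have := ler_wpM2r d0 mk8; rewrite /=; lra.
(* Both parts reduce to a deterministic claim about typical [A]; the failure probability is at most
   n^(-3), and 3 > 2. *)
have whpE (E : forall n, 'M[R]_n -> Prop) : (forall m, (N <= m.+1)%N ->
      (0 < m %/ 4)%N -> (4 * (m %/ 4) <= m)%N -> 4 <= d m.+1 -> d m.+1 <= m.+1%:R / 2 ->
      forall A, bip_typical m (m %/ 4) (d m.+1) A -> E m.+1 A) ->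
    whp (fun n => probA (P n) (E n)).
  move=> typ; exists 3; split; first by lra.
  exists N => n Nn; have := regime _ Nn; case: n Nn => [_ []//|m] Nn /= [m4 d4 dm _ err].
  have [k0 km mk] := kbounds _ m4.
  have /le_trans -> // : 1 - (m.+1%:R : R) `^ (- 3) <=
    1 - (m.+1%:R * expR (- (3 * d m.+1)) + expR (- ((m %/ 4)%:R / 32))).
    by rewrite lerD2l lerN2.
  exact: (prob_bip_typical _ _ _ _ k0 km mk d4 dm (typ _ Nn k0 km d4 dm)).
have c0 : 0 < (2 ^+ 17)^-1 :> R by rewrite invr_gt0 exprn_gt0.
split.
  exists 1%N, v, P, 4^-1, N; split; first by rewrite invr_gt0.
  split => //; exists ((2 ^+ 17)^-1); split=> //.
  apply: whpE => m Nm k0 km d4 dm A typA W What topW topA.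
  have d0 : 0 < d m.+1 by lra.
  have [hh _ gap] := bip_typical_top k0 km d0 typA topA.
  have x0 : 0 < d m.+1 / m.+1%:R by rewrite divr_gt0.
  have [a a2 ->] := bipmx_top k0 km x0 topW.
  have -> : (What *m What^T - (a *: bipvec m.+1 (m %/ 4)) *m (a *: bipvec m.+1 (m %/ 4))^T)
      *m v m.+1 = dot What (v m.+1) *: What - v m.+1.
    rewrite linearZ /= -scalemxAl -scalemxAr scalerA -expr2 a2 scale1r.
    by rewrite mulmxBl -!mulmxA !dot_mx !mul_mx_scalar (bipvec_unit k0 km) scale1r.
  rewrite -/(v m.+1) in gap; rewrite invfM in gap.
  set y := _ / d m.+1 in gap *.
  have vv : dot (v m.+1) (v m.+1) = 1 by exact: bipvec_unit.
  rewrite vnormE !dotlin hh vv [dot What _]dotC; move: gap.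
  move: (dot (v m.+1) What) => g gap.
  have y0 : 0 < y by rewrite divr_gt0.
  have y1 : y <= 1 by have := sqr_ge0 g; lra.
  (* The squared norm is 1 - g^2 >= y, and y >= y^2 since y <= 1. *)
  rewrite -[leLHS](ger0_norm (ltW y0)) -sqrtr_sqr ler_wsqrtr //.
  have : y ^+ 2 <= y by rewrite expr2 ler_piMl // ltW.
  lra.
move=> sigma s0.
pose X n : 'M[R]_(n, 1) := Num.sqrt n%:R *: covar n (n.-1 %/ 4).
(* The signal is alpha alone, of norm sqrt n, so C0 = 1; X^T X = n gives rho = 1. *)
exists 1%N, 1%N, X, P, (fun=> 0), (fun=> 0), (fun n => Num.sqrt n%:R *: v n), 1, 1, 4^-1, N.
split; first by split; rewrite ?ltr01 ?invr_gt0.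
split.
  move=> n Nn; have [PP dP _ gP CP] := model _ Nn; rewrite !mulmx0 !add0r; split => //.
  have := regime _ Nn.
  case: n Nn PP dP gP CP => [_ _ _ _ _ []//|m] _ _ _ _ _ /= [m4 d4 _ _ _].
  have [k0 km mk] := kbounds _ m4.
  have d0 : 0 < d m.+1 by lra.
  have x0 : 0 < d m.+1 / m.+1%:R by rewrite divr_gt0 ?ltr0n.
  have n0 : 0 < m.+1%:R :> R by rewrite ltr0n.
  have sn0 : Num.sqrt m.+1%:R != 0 :> R by rewrite gt_eqF // sqrtr_gt0.
  have sn2 : Num.sqrt m.+1%:R * Num.sqrt m.+1%:R = m.+1%:R :> R.
    by rewrite -expr2 sqr_sqrtr // ltW.
  have xx := covar_unit k0 km : dot (covar m.+1 (m %/ 4) : 'cV[R]_m.+1) _ = 1.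
  have XX : dot (X m.+1) (X m.+1) = m.+1%:R by rewrite /X dotZl dotZr xx mulr1 sn2.
  split.
  - apply/eqP; rewrite eqn_leq rank_leq_col lt0n mxrank_eq0.
    apply/eqP => X0; move: XX; rewrite X0 /dot mulmx0 mxE => /esym/eqP.
    by rewrite gt_eqF.
  - split=> [j|].
      rewrite (_ : col j (X m.+1) = X m.+1) ?vnormE ?XX //.
      by apply/matrixP => i i'; rewrite mxE !ord1.
    by rewrite mul1r mulr1 vnormE dotZl dotZr bipvec_unit // mulr1 sn2.
  - rewrite dot_mx XX scale_scalar_mx mulVf ?gt_eqF // invmx1 divr1.
    exists 1%:M, (const_mx 1); rewrite trmx1 mul1mx mulmx1; split => //; split.
      by rewrite diag_const_mx mulmx1.
    by move=> i; rewrite mxE lexx.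
  move=> W topW; have [a a2 WE] := bipmx_top k0 km x0 topW.
  have cap0 : ((X m.+1)^T :&: W^T)%MS = 0 by rewrite WE; exact: covar_cap.
  rewrite cap0 !trmx0 !mul0mx; split => //; first exact: sub0mx.
    apply/sub_rVP; exists (Num.sqrt m.+1%:R * a).
    by rewrite WE !linearZ /= scalerA mulrCA -expr2 a2 mulr1.
  move=> Z U S V oZ sv i j ij _; right; rewrite !ord1.
  have [c c2 ZE] := orthobasis_single sn0 xx oZ.
  have SE : S 0 0 = 3 / 5.
    apply: (svd_single (U := U) (V := V)); first by lra.
    move: sv; rewrite ZE WE dot_mx dotZl dotZr dot_covar_bipvec // mulrA.
    have /eqP : (c * a) ^+ 2 = 1 by rewrite exprMn c2 a2 mulr1.
    by rewrite sqrf_eq1 => /orP[] /eqP ->; rewrite ?mul1r ?mulN1r; [left|right].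
  by rewrite SE; lra.
(* The bias is s(1 - g^2)/q with s = 3/5 and q = 1 - (sg)^2 in [16/25, 1]: q <= 1 gives the first
   constant, q >= 16/25 the second. *)
exists (3 / 5 * (2 ^+ 17)^-1), (sigma ^+ 2 * (25 / 16)).
split; first by rewrite mulr_gt0 //; lra.
split; first by rewrite mulr_gt0 ?exprn_gt0 //; lra.
apply: whpE => m Nm k0 km d4 dm A typA W What Z Uh Sh Vh topW topA oZ sv.
have d0 : 0 < d m.+1 by lra.
have [hh hlast gap] := bip_typical_top k0 km d0 typA topA.
have x0 : 0 < d m.+1 / m.+1%:R by rewrite divr_gt0.
have [a a2 WE] := bipmx_top k0 km x0 topW.
have n0 : 0 < m.+1%:R :> R by rewrite ltr0n.
have sn0 : 0 < Num.sqrt m.+1%:R :> R by rewrite sqrtr_gt0.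
have rE : rdim (X m.+1) W = 0%N.
  by rewrite /rdim WE covar_cap ?mxrank0 // gt_eqF.
rewrite /= rE; rewrite !mulmx0 !add0r subr0 /Ebetahat /Varbetahat.
set g := dot _ What in gap.
have g1 : g ^+ 2 <= 1.
  have : 0 < (2 ^+ 17 * d m.+1)^-1 by rewrite invr_gt0 mulr_gt0 ?exprn_gt0.
  lra.
have s01 : 0 < (3 / 5 : R) < 1 by lra.
have [-> ->] := estimator_single sn0 s01 (covar_unit k0 km) hh (bipvec_unit k0 km)
  (dot_covar_bipvec k0 km) (erefl g) (dot_covar _ hlast) g1 oZ sv.
have q0 : 16 / 25 <= 1 - (3 / 5 * g) ^+ 2 <= 1 by rewrite exprMn; have := sqr_ge0 g; lra.
move: q0; set q := 1 - _ => /andP[q0 q1].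
have qpos : 0 < q by lra.
split.
  rewrite /vnorm_inf big_ord_recl big_ord0 le_max; apply/orP; left.
  rewrite mxE eqxx; apply: le_trans (ler_norm _).
  rewrite -[leLHS]mulrA -mulrA ler_pM2l ?lt_def //; last by lra.
  rewrite invfM in gap; apply: le_trans gap _.
  rewrite ler_pdivlMr // ler_piMr //; lra.
move=> j; rewrite !ord1 mxE eqxx sqr_sqrtr ?(ltW n0) // invfM.
rewrite -mulrA ler_wpM2l ?sqr_ge0 // [X in X <= _]mulrC ler_wpM2r ?invr_ge0 ?(ltW n0) //.
by rewrite -[leRHS]invrK lef_pV2 ?posrE ?invf_div //; lra.
Qed.
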